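(* Let $m$ be the locally bounded solution of the defective renewal equation $$m(u)=\phi\int_0^u m(u-y)f(y)\,dy+v(u),\quad u\ge 0,$$ with $0<\phi<1$ and $f$ the density function of an absolutely continuous nonnegative random variable $Z$ with distribution function $F$. Suppose that the following conditions hold: 1. $Z$ has finite variance. 2. $F$ and $v$ are in $C^2_0([0,\infty))$. 3. $f'$ and $v''$ are in $C^2([0,\infty))$. 4. $I_i(f'')<\infty$ for $i=0,2$. 5. $\|u^2w_i(u)\|<\infty$ for $i=1,2$. 6. $\|u^2w_i''(u)\|<\infty$ for $i=1,2$. Then $m\in\mathcal D_1$. Therefore, for all $t>0$, the approximation $M_t^{[2]}m$ satisfies $$\|M_t^{[2]}m-m\|\le \frac{1}{8t^2}\|m''(u)\|+\frac{1}{6t^2}\|u\,m'''(u)\|+\frac{9}{16t^2}\|u^2m^{iv}(u)\|<\infty .$$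
   Context: Standing assumptions: $0<\phi<1$; $F$ is the distribution function of $Z\ge 0$, with $F(0)=0$; $v:[0,\infty)\to\mathbb R$ is locally bounded. The renewal equation then has a unique locally bounded solution $m$. Function classes: $C([0,\infty))$ is the class of continuous real functions on $[0,\infty)$; $C^n([0,\infty))$ is the subclass of functions in $C([0,\infty))$ having continuous $n$-th derivative on $(0,\infty)$; $C^n_0([0,\infty))$ is the subclass of $g\in C^n([0,\infty))$ such that $\lim_{t\downarrow 0}g^{(k)}(t)$ exists and is finite for all $k=0,1,\dots,n$, and then $g^{(k)}(0)$ denotes this limit. In particular, when $F\in C_0^2([0,\infty))$, $f$ denotes the version $f=F'$ on $(0,\infty)$, with $f(0),f'(0)$ the limits at $0$. Norms: $\|g\|$ is the supremum of $|g|$ over its domain (over $(0,\infty)$ for expressions involving derivatives defined only there), and $\|u^jg(u)\|$ is the supremum of $u^j|g(u)|$. $I_i(h):=\int_0^\infty y^i|h(y)|\,dy$. $w_1(u):=\phi\, m(0)f(u)+v'(u)$ and $w_2(u):=\phi\, m'(0)f(u)+w_1'(u)$, where $m'(0)=\lim_{u\downarrow 0}m'(u)$ (which exists under condition 2). $\mathcal D_1:=\{g\in C^4([0,\infty)):\ \|g''(u)\|<\infty \text{ and } \|u^2g^{iv}(u)\|<\infty\}$. Operators: for $g\in C([0,\infty))$ with $|g(u)|=O(e^{\gamma u})$ as $u\to\infty$ for some $\gamma\ge 0$, and $t>\gamma$, let $\tilde g(t)=\int_0^\infty e^{-tu}g(u)\,du$ and $$L_t^*g(u)=\frac{(-1)^{[tu]}t^{[tu]+1}}{\Gamma([tu]+1)}\tilde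 g^{([tu])}(t)=E\,g\!\left(\frac{S([tu]+1)}{t}\right),\quad u\ge 0,$$ where $[x]$ is the integer part of $x$ and $S(r)$ is a gamma random variable with shape $r$ and scale $1$. Whenever these quantities are defined (it is part of the assertion that they are for $g=m$ and every $t>0$), set $M_t^{[2]}g(0)=g(0)$, $$M_t^{[2]}g\!\left(\frac kt\right)=2L_{2t}^*g\!\left(\frac{2k-1}{2t}\right)-L_t^*g\!\left(\frac{k-1}{t}\right),\quad k=1,2,\dots,$$ and for $u>0$ not of the form $k/t$, $k=1,2,\dots$, $$M_t^{[2]}g(u)=(tu-[tu])\,M_t^{[2]}g\!\left(\frac{[tu]+1}{t}\right)+([tu]+1-tu)\,M_t^{[2]}g\!\left(\frac{[tu]}{t}\right).$$ *)

(* Defs.v *)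
From HB Require Import structures.
From mathcomp Require Export all_boot all_order all_algebra.
From mathcomp Require Export all_classical all_reals all_analysis.
Export Order.TTheory GRing.Theory Num.Theory.
Export numFieldNormedType.Exports.

Set Implicit Arguments.
Unset Strict Implicit.
Unset Printing Implicit Defensive.

#[global] Open Scope ring_scope.
#[global] Open Scope classical_set_scope.

(* A function on [0, oo) is represented by a function R -> R whose values on
   the negative half-line are never looked at: derivatives are only taken at
   positive points, and continuity at 0 is relative to [0, oo). *)

Section function_classes.
Context {R : realType}.
Implicit Types (g : R -> R) (n k : nat).

Definition C0 g := {within `[0, +oo[, continuous g}.

Definition Cn n g :=
  [/\ C0 g,
      forall k, (k < n)%N -> forall u : R, 0 < u -> derivable (g^`(k)) u 1 &
      {in `]0, +oo[, continuous (g^`(n))}].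

Definition Cn0 n g :=
  Cn n g /\ forall k, (k <= n)%N -> cvg (g^`(k) x @[x --> 0^'+]).

(* The n-th derivative on (0, oo), extended to 0 by its right limit there
   (meaningful at 0 only when that limit exists, as for g in Cn0 n). *)
Definition dern n g (u : R) : R :=
  if u == 0 then lim (g^`(n) x @[x --> 0^'+]) else g^`(n) u.

Definition locally_bounded g := forall a : R, [bounded g x | x in `[0, a]].

Definition supnorm (A : set R) g : \bar R := ereal_sup [set `|g u|%:E | u in A].

(* || u^j g(u) ||, with g possibly undefined at 0 *)
Definition wnorm (j : nat) g : \bar R :=
  supnorm `]0, +oo[ (fun u => u ^+ j * g u).

Definition Iabs (i : nat) (h : R -> R) : \bar R :=
  (\int[@lebesgue_measure R]_(y in `]0%R, +oo[) (y ^+ i * `|h y|)%:E)%E.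

Definition classD1 g :=
  [/\ Cn 4 g, (wnorm 0 (dern 2 g) < +oo)%E & (wnorm 2 (dern 4 g) < +oo)%E].

End function_classes.

Section renewal.
Context {R : realType}.

Definition renewal_solution (phi : R) (f v m : R -> R) :=
  forall u : R, 0 <= u ->
    (@lebesgue_measure R).-integrable `[0, u]
      (fun y => (m (u - y) * f y)%:E) /\
    m u = phi * (\int[@lebesgue_measure R]_(y in `[0, u]) (m (u - y) * f y)) + v u.

Definition w1 (phi : R) (f v m : R -> R) (u : R) : R :=
  phi * m 0 * f u + dern 1 v u.

Definition w2 (phi : R) (f v m : R -> R) (u : R) : R :=
  phi * dern 1 m 0 * f u + dern 1 (w1 phi f v m) u.

End renewal.

Section operators.
Context {R : realType}.
Implicit Types (g : R -> R) (t u : R).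

Definition laplace g t : R :=
  \int[@lebesgue_measure R]_(u in `[0, +oo[) (expR (- (t * u)) * g u).

(* n`! is Gamma(n + 1) *)
Definition Lstar t g u : R :=
  let n := Num.truncn (t * u) in
  (-1) ^+ n * t ^+ n.+1 / n`!%:R * derive1n n (laplace g) t.

(* The domain of L*_t: g is continuous of exponential order gamma < t; the
   Laplace integral then converges and is smooth at t, which is recorded since
   integrals and derivatives are total functions here. *)
Definition Lstar_defined t g :=
  [/\ C0 g,
      exists gamma : R, [/\ 0 <= gamma, gamma < t &
        exists C : R, \forall u \near +oo, `|g u| <= C * expR (gamma * u)],
      (@lebesgue_measure R).-integrable `[0, +oo[
        (fun u => (expR (- (t * u)) * g u)%:E) &
      forall n, derivable ((laplace g)^`(n)) t 1].

Definition M2_node t g (k : nat) : R :=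
  if k == 0%N then g 0
  else 2 * Lstar (2 * t) g ((2 * k%:R - 1) / (2 * t))
       - Lstar t g ((k%:R - 1) / t).

Definition M2 t g u : R :=
  let k := Num.truncn (t * u) in
  if t * u == k%:R then M2_node t g k
  else (t * u - k%:R) * M2_node t g k.+1 + (k.+1%:R - t * u) * M2_node t g k.

Definition M2_defined t g := Lstar_defined t g /\ Lstar_defined (2 * t) g.

End operators.

(* Main.v *)
(* The renewal equation is differentiated under the convolution: if
   h = phi (h * f) + w, then h' = phi (f(0) h + h * f') + w', which is also
   h' = phi (h' * f) + (phi h(0) f + w').  Thus m' and m'' solve renewal equations
   with forcing terms w_1 and w_2, and two more derivatives of each fall on f, so
   that m''' and m'''' are expressed through m', m'', their convolutions with f''
   and w_1'', w_2''.  Since phi < 1 and f is a density, taking suprema in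
   h = phi (h * f) + w bounds h by w; multiplying by u^2 and using
   u^2 <= (1 + e) (u - y)^2 + (1 + 1/e) y^2 together with the second moment of f
   bounds u^2 h as well.

   For the error bound, M_t(k/t) = 2 E g(S(2k)/(2t)) - E g(S(k)/t) for gamma
   variables of common mean a = k/t.  In the third order Taylor expansion at a the
   second order terms cancel and the third order ones leave - a g'''(a) / (6 t^2).
   The remainder, controlled through |g''''(x)| <= K / x^2, is dominated by a
   quartic polynomial in s - a, whose gamma moments are explicit.  Linear
   interpolation between nodes costs |g''| / (8 t^2). *)

Require Import Defs.
From mathcomp Require Import measurable_realfun ring lra.

Set Implicit Arguments.
Unset Strict Implicit.
Unset Printing Implicit Defensive.

(** * Functions on the half-line *)

Section half_line.
Context {R : realType}.
Implicit Types (f g h : R -> R) (a b u x : R).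

(** At the outset [m] is only locally bounded, so its measurability and then its continuity have to
    be extracted from the equation before anything is differentiated. The other difficulty sits at
    0: [f''] need not have a limit there, so derivatives are taken on the open half-line, continuity
    at 0 is tracked separately, and [f''] enters convolutions merely as a locally integrable kernel.
    Hence convolutions are differentiated by integrating the candidate derivative (Fubini) and
    applying the fundamental theorem of calculus, not under the integral sign. Nor is any supremum
    over the half-line known to be finite beforehand: each estimate is made at a maximum point of a
    compact interval [0, u], with a constant independent of u. In the error bound the weight 1 / x^2
    is singular at 0, and gamma variables of shape 1 or 2 have no inverse second moment. A
    polynomial majorant of the remainder avoids inverse moments altogether; it carries a parameter
    that must grow with the node k, while the constant 9/16 leaves little room at k = 1. *)

Definition dpos g g' := forall u : R, 0 < u -> is_derive u 1 g (g' u).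

Lemma near_pos (u : R) : 0 < u -> \forall x \near u, 0 < x.
Proof. by move=> u0; exact: lt_nbhsr. Qed.

Lemma C0P g : C0 g <->
  (forall u, 0 < u -> {for u, continuous g}) /\ g x @[x --> 0^'+] --> g 0.
Proof.
rewrite /C0; split.
  by move/continuous_within_itvcyP => [h1 h2]; split => // u u0;
    apply: h1; rewrite in_itv/= u0.
move=> [h1 h2]; apply/continuous_within_itvcyP; split => // u.
by rewrite in_itv/= andbT => /h1.
Qed.

(** Freezing [g] at [g 0] on the left trades continuity on a subspace for continuity on the whole
    line, where the algebra of limits and composition apply directly. *)
Lemma C0_clamp g : C0 g <-> continuous (fun x => g (Num.max 0 x)).
Proof.
split; last first.
  move=> cg; apply: (@subspace_eq_continuous _ _ _ (fun x => g (Num.max 0 x))).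
    by move=> x; rewrite inE/= in_itv/= andbT /from_subspace/= => x0; rewrite max_r.
  exact: continuous_subspaceT.
move/C0P => [h1 h2]; set G := (G in continuous G).
have Gp y : 0 <= y -> G y = g y by move=> y0; rewrite /G max_r.
have Gn y : y <= 0 -> G y = g 0 by move=> y0; rewrite /G max_l.
clearbody G => x; rewrite /continuous_at; have [x0|x0|<-] := ltgtP 0 x.
- rewrite Gp ?ltW//; apply: cvg_trans (h1 _ x0).
  apply: near_eq_cvg; near=> y; rewrite Gp// ltW//.
  by near: y; exact: near_pos.
- rewrite Gn ?ltW//.
  apply: cvg_near_cst; near=> y.
  by rewrite Gn// ltW//; near: y; exact: (lt_nbhsl x0).
- apply/left_right_continuousP; rewrite Gp//; split.
    apply: cvg_near_cst; near=> y.
    by rewrite Gn//; near: y; exact: nbhs_left_le.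
  apply: cvg_trans h2; apply: near_eq_cvg; near=> y.
  by rewrite Gp//; near: y; exact: nbhs_right_ge.
Unshelve. all: by end_near. Qed.

Lemma C0_eq f g : (forall u, 0 <= u -> f u = g u) -> C0 f -> C0 g.
Proof.
move=> fg /C0_clamp cf; apply/C0_clamp.
by under eq_fun do rewrite -fg ?le_max ?lexx//.
Qed.

Lemma continuous_C0 f : continuous f -> C0 f.
Proof. by move=> cf; exact: continuous_subspaceT. Qed.

Lemma C0D f g : C0 f -> C0 g -> C0 (fun x => f x + g x).
Proof.
move=> /C0_clamp cf /C0_clamp cg; apply/C0_clamp => x.
by apply: continuousD; [exact: cf|exact: cg].
Qed.

Lemma C0M f g : C0 f -> C0 g -> C0 (fun x => f x * g x).
Proof.
move=> /C0_clamp cf /C0_clamp cg; apply/C0_clamp => x.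
by apply: continuousM; [exact: cf|exact: cg].
Qed.

Lemma C0_cst (c : R) : C0 (fun=> c).
Proof. by apply: continuous_C0 => x; exact: cvg_cst. Qed.

Lemma C0Z (c : R) f : C0 f -> C0 (fun x => c * f x).
Proof. by move=> cf; apply: C0M => //; exact: C0_cst. Qed.

Lemma C0N f : C0 f -> C0 (fun x => - f x).
Proof.
by move=> cf; under eq_fun do rewrite -mulN1r; exact: C0Z.
Qed.

Lemma C0_at g u : C0 g -> 0 < u -> {for u, continuous g}.
Proof. by move=> /C0P[+ _]; exact. Qed.

Lemma C0_within a b g : C0 g -> 0 <= a -> {within `[a, b], continuous g}.
Proof.
move=> cg a0; apply: continuous_subspaceW cg => x /=; rewrite !in_itv/= andbT.
by move=> /andP[+ _]; exact: le_trans.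
Qed.

Lemma C0_bounded g b : C0 g -> exists2 M, 0 <= M &
  forall x, 0 <= x <= b -> `|g x| <= M.
Proof.
move=> cg.
have /compact_bounded : compact (g @` `[0, b]).
  by apply: continuous_compact; [exact: C0_within|exact: segment_compact].
move=> [M [Mr /(_ (Num.max 0 M + 1))]] H.
exists (Num.max 0 M + 1); first by rewrite addr_ge0// le_max lexx.
move=> x xb; apply: H; first by rewrite ltr_pwDr// le_max lexx orbT.
by exists x => //=; rewrite in_itv.
Qed.

Lemma dpos_continuous g g' u : dpos g g' -> 0 < u -> {for u, continuous g}.
Proof.
move=> dg u0; apply/differentiable_continuous/derivable1_diffP.
by have ? := dg u u0; exact: ex_derive.
Qed.

Lemma dpos_eq f g f' : (forall u, 0 < u -> f u = g u) -> dpos f f' -> dpos g f'.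
Proof.
move=> fg df u u0; apply: near_eq_is_derive (df u u0).

near=> y; apply/fg; near: y; exact: near_pos.
Unshelve. all: by end_near. Qed.

Lemma dpos_eqr f f' g' : (forall u, 0 < u -> f' u = g' u) ->
  dpos f f' -> dpos f g'.
Proof. by move=> fg df u u0; rewrite -fg//; exact: df. Qed.

Lemma dpos_derive1 g g' u : dpos g g' -> 0 < u -> g^`() u = g' u.
Proof. by move=> dg u0; rewrite derive1E; have ? := dg u u0; exact: derive_val. Qed.

Lemma dern_gt0 n g u : 0 < u -> dern n g u = g^`(n) u.
Proof. by move=> u0; rewrite /dern gt_eqF. Qed.

Lemma dpos_dern1 g g' u : dpos g g' -> 0 < u -> dern 1 g u = g' u.
Proof. by move=> dg u0; rewrite dern_gt0// derive1n1; exact: dpos_derive1. Qed.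

(** The case u = 0 matters: it identifies the right limits hidden in [w2], in particular m'(0), with
    values of continuous functions. *)
Lemma dpos_dern1_C0 g g' : dpos g g' -> C0 g' ->
  forall u, 0 <= u -> dern 1 g u = g' u.
Proof.
move=> dg /C0P[_ cg] u; rewrite le_eqVlt => /predU1P[<-|]; last exact: dpos_dern1.
rewrite /dern eqxx derive1n1; apply/cvg_lim => //.
apply: cvg_trans cg; apply: near_eq_cvg; near=> x.
by rewrite (dpos_derive1 dg).
Unshelve. all: by end_near. Qed.

Lemma Cn_dpos n g k : Cn n g -> (k < n)%N -> dpos (dern k g) (dern k.+1 g).
Proof.
move=> [_ dg _] kn.
apply: (@dpos_eq (g^`(k))); first by move=> u u0; rewrite dern_gt0.
move=> u u0; rewrite dern_gt0// derive1nS derive1E; apply/derivableP.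
exact: dg.
Qed.

Lemma Cn_continuous n g u : Cn n g -> 0 < u -> {for u, continuous (dern n g)}.
Proof.
move=> [_ _ cg] u0.
have {}cg : {for u, continuous g^`(n)} by apply: cg; rewrite inE/= in_itv/= u0.
rewrite /prop_for /continuous_at (dern_gt0 n g u0).
apply: cvg_trans cg.
apply: near_eq_cvg; near=> x; rewrite dern_gt0//.
by near: x; exact: near_pos.
Unshelve. all: by end_near. Qed.

Lemma Cn0_C0 n g k : Cn0 n g -> (0 < k <= n)%N -> C0 (dern k g).
Proof.
move=> [cng lg] /andP[k0 kn]; apply/C0P; split => [u u0|].
  move: kn; rewrite leq_eqVlt => /predU1P[->|kn]; first exact: Cn_continuous.
  exact: dpos_continuous (Cn_dpos cng kn) u0.
rewrite [in X in _ --> X]/dern eqxx.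
apply: cvg_trans (lg k kn); apply: near_eq_cvg; near=> x.
by rewrite dern_gt0.
Unshelve. all: by end_near. Qed.

Lemma Cn_C0 n g : Cn n g -> C0 g. Proof. by case. Qed.

Lemma Cn0_Cn n g : Cn0 n g -> Cn n g. Proof. by case. Qed.

(** Mean value inequality: [F + f] and [F - f] are both nondecreasing. It takes the place of
    integral remainders in the estimates below, since [f'] need not be integrable or continuous. *)
Lemma le_increment f F f' F' a b : a <= b ->
  {within `[a, b], continuous f} -> {within `[a, b], continuous F} ->
  (forall x, a < x < b -> is_derive x 1 f (f' x)) ->
  (forall x, a < x < b -> is_derive x 1 F (F' x)) ->
  (forall x, a < x < b -> `|f' x| <= F' x) ->
  `|f b - f a| <= F b - F a.
Proof.
move=> ab cf cF df dF fF.
have aab : a \in `[a, b]%R by rewrite in_itv/= lexx.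
have bab : b \in `[a, b]%R by rewrite in_itv/= lexx ab.
rewrite ler_norml; apply/andP; split.
  suff : (F \+ f) a <= (F \+ f) b by rewrite /=; lra.
  apply: (@ger0_derive1_le_cc _ (F \+ f) a b) => //.
  - move=> x xab; apply: ex_derive; apply: is_deriveD; [exact: dF|exact: df].
  - move=> x xab; rewrite derive1E.
    have /@derive_val -> := is_deriveD (dF x xab) (df x xab).
    by have := fF x xab; rewrite ler_norml => /andP[]; lra.
  - by move=> x; apply: continuousD; [exact: cF|exact: cf].
suff : (F \- f) a <= (F \- f) b by rewrite /=; lra.
apply: (@ger0_derive1_le_cc _ (F \- f) a b) => //.
- move=> x xab; apply: ex_derive; apply: is_deriveB; [exact: dF|exact: df].
- move=> x xab; rewrite derive1E.
  have /@derive_val -> := is_deriveB (dF x xab) (df x xab).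
  by have := fF x xab; rewrite ler_norml => /andP[]; lra.
- by move=> x; apply: continuousB; [exact: cF|exact: cf].
Qed.

End half_line.

(** * Convolution on the half-line *)

Section reflection.
Context {R : realType}.
Implicit Types (c u : R).

Lemma measurable_refl c : measurable_fun setT (fun x : R => c - x).
Proof. by apply: measurable_funB. Qed.

(** By uniqueness of Lebesgue measure it is enough to look at half-open intervals; the preimage is
    closed at the other end but has the same length. *)
Lemma pushforward_refl c (A : set R) : measurable A ->
  pushforward (@lebesgue_measure R) (fun x : R => c - x) A = @lebesgue_measure R A.
Proof.
move=> mA; have mc := measurable_refl c.
pose f : measurableTypeR R -> measurableTypeR R := fun x : R => c - x.
pose M : {measure set (measurableTypeR R) -> \bar R} :=
  measure_function_pushforward__canonical__measure_function_Measure
    (@lebesgue_measure R) (mc : measurable_fun setT f).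
apply/esym/(@lebesgue_measure_unique R M) => // _ [[a b] _ <-].
rewrite /M/= /pushforward.
have -> : (fun x : R => c - x) @^-1` [set` `]a, b]%R] = [set` `[c - b, c - a[%R].
  by apply/seteqP; split => x /=; rewrite !in_itv/=; lra.
rewrite !lebesgue_measure_itv/= !lte_fin ltrD2l ltrN2; case: ifP => // _.
by rewrite -!EFinB; congr EFin; lra.
Qed.

Local Open Scope ereal_scope.

Lemma ge0_integral_refl c (h : R -> \bar R) : measurable_fun setT h ->
  (forall x, 0 <= h x) ->
  \int[@lebesgue_measure R]_x h (c - x)%R = \int[@lebesgue_measure R]_x h x.
Proof.
move=> mh h0.
pose f : measurableTypeR R -> measurableTypeR R := fun x : R => (c - x)%R.
have mf : measurable_fun setT f := measurable_refl c.
transitivity (\int[pushforward (@lebesgue_measure R) f]_x h x).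
  by rewrite (ge0_integral_pushforward mf).
by apply: eq_measure_integral => A mA _; exact: pushforward_refl.
Qed.

Lemma integrable_refl c (h : R -> \bar R) :
  (@lebesgue_measure R).-integrable setT h ->
  (@lebesgue_measure R).-integrable setT (fun x => h (c - x)%R).
Proof.
move=> /integrableP[mh hoo]; apply/integrableP; split.
  exact: (measurableT_comp mh (measurable_refl c)).
rewrite (ge0_integral_refl c (h := fun x => `|h x|))//.
exact: measurableT_comp.
Qed.

Lemma integral_refl c (h : R -> \bar R) :
  (@lebesgue_measure R).-integrable setT h ->
  \int[@lebesgue_measure R]_x h (c - x)%R = \int[@lebesgue_measure R]_x h x.
Proof.
move=> ih; have mh := measurable_int _ ih.
rewrite -[fun x => _]/(h \o (fun x : R => c - x)%R).
rewrite integralE [RHS]integralE funepos_comp funeneg_comp.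
by congr (_ - _); apply: ge0_integral_refl => //;
  [exact: measurable_funepos|exact: measurable_funeneg].
Qed.

Let restrict_refl u (h : R -> \bar R) :
  (fun x => (h \_ `[0%R, u]) (u - x)%R) = (fun x => h (u - x)%R) \_ `[0%R, u].
Proof.
apply/funext => x; rewrite !patchE; congr (if _ then _ else _).
by apply/idP/idP; rewrite !inE/= !in_itv/=; lra.
Qed.

Lemma integrable_refl_itv u (h : R -> \bar R) :
  (@lebesgue_measure R).-integrable `[0%R, u] h ->
  (@lebesgue_measure R).-integrable `[0%R, u] (fun x => h (u - x)%R).
Proof.
move=> /integrable_mkcond ih; apply/integrable_mkcond => //.
by rewrite -restrict_refl; apply: integrable_refl; exact: ih.
Qed.

Lemma integral_refl_itv u (h : R -> \bar R) :
  (@lebesgue_measure R).-integrable `[0%R, u] h ->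
  \int[@lebesgue_measure R]_(x in `[0%R, u]) h (u - x)%R =
  \int[@lebesgue_measure R]_(x in `[0%R, u]) h x.
Proof.
move=> /integrable_mkcond ih.
rewrite integral_mkcond -restrict_refl [RHS]integral_mkcond.
by apply: integral_refl; exact: ih.
Qed.

End reflection.

Section convolution.
Context {R : realType}.
Local Notation mu := (@lebesgue_measure R).
Implicit Types (a b p q f g : R -> R) (u x y z M : R).

Definition locint p := forall c : R, mu.-integrable `[0, c] (EFin \o p).

(** The arguments are not interchangeable without an integrability proof ([convC]): the second slot
    is typically the one that receives a merely locally integrable kernel. *)
Definition conv a p u := \int[mu]_(z in `[0, u]) (a (u - z) * p z).

Lemma bounded_onP (D : set R) f M : (forall x, D x -> `|f x| <= M) ->
  [bounded f x | x in D].
Proof.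
move=> fM; exists M; split; rewrite ?num_real// => N MN x Dx.
by apply: le_trans (fM x Dx) _; exact: ltW.
Qed.

Lemma C0_locint g : C0 g -> locint g.
Proof.
move=> cg b; apply: continuous_compact_integrable; first exact: segment_compact.
exact: C0_within.
Qed.

Lemma bounded_locint g : (forall c : R, measurable_fun `[0, c] g) ->
  locally_bounded g -> locint g.
Proof.
move=> mg bg b; apply: measurable_bounded_integrable => //; last exact: mg.
by rewrite /= lebesgue_measure_itv/=; case: ifP => // _; rewrite -EFinB ltry.
Qed.

Lemma integrable_continuousM (D : set R) g p M : measurable D ->
  continuous g -> (forall x, D x -> `|g x| <= M) ->
  mu.-integrable D (EFin \o p) ->
  mu.-integrable D (fun x => (g x * p x)%:E).
Proof.
move=> mD cg gM ip.
under eq_fun do rewrite EFinM; apply: integrableMr => //.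
  by apply: measurable_funTS; exact: continuous_measurable_fun.
exact: bounded_onP gM.
Qed.

Lemma continuous_subl g u : continuous g -> continuous (fun z => g (u - z)).
Proof.
move=> cg z; apply: (@continuous_comp _ _ _ (fun z => u - z) g).
  by apply: continuousB => //; exact: cvg_cst.
exact: cg.
Qed.

Lemma conv_integrable g p u : C0 g -> mu.-integrable `[0, u] (EFin \o p) ->
  mu.-integrable `[0, u] (fun z => (g (u - z) * p z)%:E).
Proof.
move=> cg ip.
have [M M0 gM] := C0_bounded u cg.
suff : mu.-integrable `[0, u] (fun z => (g (Num.max 0 (u - z)) * p z)%:E).
  apply: eq_integrable => // z; rewrite inE/= in_itv/= => zu.
  by rewrite max_r//; lra.
apply: (@integrable_continuousM _ (fun z => g (Num.max 0 (u - z))) _ M) => //.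
  by apply: (@continuous_subl (fun x => g (Num.max 0 x))); exact/C0_clamp.
move=> z /=; rewrite in_itv/= => zu.
by rewrite max_r ?gM//; lra.
Qed.

Lemma convC a p u : mu.-integrable `[0, u] (fun z => (a (u - z) * p z)%:E) ->
  conv a p u = conv p a u.
Proof.
move=> iap; rewrite /conv /Rintegral -integral_refl_itv//.
by congr fine; apply: eq_integral => z _; rewrite subKr mulrC.
Qed.

Lemma conv0 a p : conv a p 0 = 0.
Proof. by rewrite /conv set_itv1 Rintegral_set1. Qed.

Lemma le_conv a p u M : mu.-integrable `[0, u] (EFin \o p) ->
  mu.-integrable `[0, u] (fun z => (a (u - z) * p z)%:E) ->
  (forall x, 0 <= x <= u -> `|a x| <= M) ->
  `|conv a p u| <= M * \int[mu]_(z in `[0, u]) `|p z|.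
Proof.
move=> ip iap aM; rewrite /conv.
apply: le_trans (le_normr_Rintegral _ _) _ => //.
rewrite -RintegralZl//; last exact: (integrable_norm ip).
apply: le_Rintegral => //.
- exact: (integrable_norm iap).
- have : mu.-integrable `[0, u] (fun z => (M%:E * `|p z|%:E)%E).
    by apply: integrableZl => //; exact: (integrable_norm ip).
  exact.
- move=> z /=; rewrite in_itv/= => zu; rewrite normrM ler_wpM2r// aM//; lra.
Qed.

End convolution.

(** * Continuity of convolutions *)

Section convolution_continuity.
Context {R : realType}.
Local Notation mu := (@lebesgue_measure R).
Implicit Types (p q f g : R -> R) (u x y z M : R).

Lemma C0_segments g : (forall c : R, 0 < c -> {within `[0, c], continuous g}) ->
  C0 g.
Proof.
move=> cg; apply/C0P; split=> [u u0|].
  have u10 : 0 < u + 1 by rewrite addr_gt0.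
  have /(continuous_within_itvP _ u10) [+ _ _] := cg _ u10.
  by apply; rewrite in_itv/= u0 ltrDl ltr01.
by have /(continuous_within_itvP _ ltr01) [] := cg _ ltr01.
Qed.

Lemma within_eq (D : set R) f g : {in D, f =1 g} ->
  {within D, continuous f} -> {within D, continuous g}.
Proof. by move=> fg; apply: subspace_eq_continuous => x xD; rewrite /from_subspace fg. Qed.

Lemma Rint_primitive_C0 p : locint p -> C0 (fun u => \int[mu]_(z in `[0, u]) p z).
Proof.
move=> ip; apply: C0_segments => c c0.
exact: (parameterized_integral_continuous (ltW c0) (ip c)).
Qed.

Lemma Rintegral_itv_eq0r f u c : 0 <= u <= c ->
  mu.-integrable `[0, c] (EFin \o f) -> (forall z, u < z <= c -> f z = 0) ->
  \int[mu]_(z in `[0, c]) f z = \int[mu]_(z in `[0, u]) f z.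
Proof.
move=> /andP[u0 uc] fi f0; apply/eqP; rewrite -subr_eq0; apply/eqP.
rewrite (@Rintegral_itvB _ f (BLeft 0) (BRight c))//.
rewrite (@eq_Rintegral _ _ _ _ _ (fun=> 0)) ?Rintegral_cst ?mul0r//.
by move=> z; rewrite inE/= in_itv/= => /f0.
Qed.

(** The domain [0, u] moves with u. Splitting off the constant [g 0] leaves [G0], which vanishes at
    negative arguments, so its integral may be taken over a fixed [0, c] and dominated convergence
    applies; the constant part contributes [g 0] times a primitive of [p]. *)
Lemma conv_continuous g p : C0 g -> locint p -> C0 (conv g p).
Proof.
move=> cg ip; apply: C0_segments => c c0.
pose G0 x := g (Num.max 0 x) - g 0.
have cG0 : continuous G0.
  move=> x; apply: continuousB; last exact: cvg_cst.
  by move/C0_clamp : cg => /(_ x).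
have [M M0 gM] := C0_bounded (c + 1) cg.
have G0M x : x <= c + 1 -> `|G0 x| <= M + M.
  move=> xc; apply: le_trans (ler_normB _ _) _; apply: lerD; apply: gM.
    by rewrite le_max lexx/= ge_max xc andbT; lra.
  by rewrite lexx; lra.
have iG0 x : x < c + 1 ->
    mu.-integrable `[0, c] (fun z => (G0 (x - z) * p z)%:E).
  move=> xc; apply: (@integrable_continuousM _ _ (fun z => G0 (x - z)) _ (M + M)) => //.
    exact: continuous_subl.
  by move=> z /=; rewrite in_itv/= => zc; apply: G0M; lra.
pose K x := \int[mu]_(z in `[0, c]) (G0 (x - z) * p z).
have cK : {in `](-1), (c + 1)[, continuous K}.
  apply: (@continuity_under_integral _ _ _ mu (fun x z => G0 (x - z) * p z)
    `[0, c] _ (-1) (c + 1) _ _ (fun z => (M + M) * `|p z|)) => //.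
  - by move=> x /=; rewrite in_itv/= => xc; apply: iG0; lra.
  - apply: aeW => z _ x _; apply: cvgM; last exact: cvg_cst.
    apply: (@continuous_comp _ _ _ (fun x => x - z) G0); last exact: cG0.
    by apply: continuousB => //; exact: cvg_cst.
  - have : mu.-integrable `[0, c] (fun z => ((M + M)%:E * `|p z|%:E)%E).
      by apply: integrableZl => //; exact: (integrable_norm (ip c)).
    exact.
  - move=> x xc; apply: aeW => z zc; rewrite normrM ler_wpM2r// G0M//.
    by move: xc zc => /=; rewrite !in_itv/=; lra.
pose P u := \int[mu]_(z in `[0, u]) p z.
apply: (@within_eq _ ((cst (g 0) \* P) \+ K)).
  move=> u; rewrite inE/= in_itv/= => /andP[u0 uc]; rewrite /P.
  have uc1 : u < c + 1 by rewrite (le_lt_trans uc)// ltrDl.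
  have -> : K u = \int[mu]_(z in `[0, u]) (G0 (u - z) * p z).
    apply: Rintegral_itv_eq0r; [by rewrite u0|exact: iG0|move=> z zu].
    by rewrite /G0 max_l ?subrr ?mul0r//; lra.
  have ipu := ip u.
  have iG0u : mu.-integrable `[0, u] (fun z => (G0 (u - z) * p z)%:E).
    apply: integrableS (iG0 u uc1) => //.
    by apply: subset_itvl; rewrite bnd_simp.
  rewrite -RintegralZl// -RintegralD//; last first.
    exact: (@integrableZl _ _ _ mu _ _ (g 0) (EFin \o p)).
  apply: eq_Rintegral => z; rewrite inE/= in_itv/= => zu.
  by rewrite /G0 max_r; [ring|lra].
move=> x; apply: continuousD.
  apply: continuousM; first exact: cvg_cst.
  exact: (C0_within (Rint_primitive_C0 ip)).
apply: (continuous_subspaceW (B := `](-1), (c + 1)[)).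
  by move=> z /=; rewrite !in_itv/=; lra.
apply/continuous_in_subspaceT; exact: cK.
Qed.

End convolution_continuity.

(** * Fubini for convolutions *)

Section convolution_derivative.
Context {R : realType}.
Local Notation mu := (@lebesgue_measure R).
Implicit Types (p q f g : R -> R) (u x y z M : R).

(** A translation is the composition of two reflections. *)
Lemma ge0_integral_shift y (h : R -> \bar R) : measurable_fun setT h ->
  (forall x, (0 <= h x)%E) ->
  (\int[mu]_x h (x - y)%R = \int[mu]_x h x)%E.
Proof.
move=> mh h0; rewrite -(ge0_integral_refl (- y) mh h0).
rewrite -(@ge0_integral_refl _ 0 (fun x => h (- y - x)))//.
  by apply: eq_integral => x _; congr h; ring.
exact: (measurableT_comp mh (measurable_refl _)).
Qed.

Lemma integral_shift y (h : R -> \bar R) : mu.-integrable setT h ->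
  (\int[mu]_x h (x - y)%R = \int[mu]_x h x)%E.
Proof.
move=> ih; rewrite -(integral_refl (- y) ih).
rewrite -(@integral_refl _ 0 (fun x => h (- y - x))).
  by apply: eq_integral => x _; congr h; ring.
exact: (integrable_refl (- y) ih).
Qed.

Lemma integrable_shift y (h : R -> \bar R) : mu.-integrable setT h ->
  mu.-integrable setT (fun x => h (x - y)).
Proof.
move=> ih.
have := integrable_refl 0 (integrable_refl (- y) ih).
by under eq_fun => x do rewrite sub0r opprK addrC.
Qed.

Lemma conv_integrableC g p u : C0 g -> locint p ->
  mu.-integrable `[0, u] (fun z => (p (u - z) * g z)%:E).
Proof.
move=> cg ip; have := integrable_refl_itv (conv_integrable cg (ip u)).
rewrite (_ : (fun x : R => _) = fun z => (p (u - z) * g z)%:E)//.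
by apply/funext => z /=; rewrite subKr mulrC.
Qed.

Lemma mem_itv (i : interval R) x : (x \in [set` i]) = (x \in i).
Proof. by apply/idP/idP => [/set_mem|xi]; last exact: mem_set. Qed.

(** Fubini on the triangle 0 <= z <= x <= u, carried out on the whole plane with the zero extensions
    [ph] and [gh]. No bound on [p] near 0 is involved. *)
Lemma Rint_conv g p u : C0 g -> locint p -> 0 <= u ->
  \int[mu]_(x in `[0, u]) conv g p x =
  conv (fun x => \int[mu]_(z in `[0, x]) p z) g u.
Proof.
move=> cg ip u0.
pose ph := p \_ `[0, u]; pose gh := g \_ `[0, u].
have mph : measurable_fun setT ph.
  by apply/(measurable_restrictT _ _).1 => //; apply/measurable_EFinP; exact: (measurable_int mu (ip u)).
have mgh : measurable_fun setT gh.
  apply/(measurable_restrictT _ _).1 => //; apply/measurable_EFinP.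
  exact: (measurable_int mu (C0_locint cg u)).
have iph : mu.-integrable setT (EFin \o ph).
  by have /integrable_mkcond := ip u; rewrite restrict_EFin; apply.
have mi : measurable_fun setT (\1_`[0, u] : R -> R) by exact: measurable_indic.
have mphz z : measurable_fun setT (fun x => ph (x - z)).
  by apply: (measurableT_comp mph); exact: measurable_funB.
pose Phi (sz : R * R) : \bar R := (ph (sz.1 - sz.2) * \1_`[0, u] sz.1 * gh sz.2)%:E.
have mPhi : measurable_fun setT Phi.
  apply/measurable_EFinP; apply: measurable_funM; last first.
    exact: (measurableT_comp mgh measurable_snd).
  apply: measurable_funM; last first.
    exact: (measurableT_comp mi measurable_fst).
  apply: (measurableT_comp mph).
  by apply: measurable_funB; [exact: measurable_fst|exact: measurable_snd].
have [M M0 gM] := C0_bounded u cg.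
have gh_le z : `|gh z| <= M * \1_`[0, u] z.
  rewrite /gh patchE indicE; case: ifPn => [|]; last by rewrite normr0 mulr0.
  by rewrite inE/= in_itv/= mulr1 => /gM.
pose C := (\int[mu]_x `|(ph x)%:E|)%E.
have Cfin : C \is a fin_num.
  by rewrite ge0_fin_numE ?integral_ge0//; case/integrableP : iph.
(* Tonelli, integrating in x first: by translation invariance the inner integral is at most [M]
   times the L1 norm [C] of [ph], and it vanishes for z outside [0, u]. *)
have iPhi : (mu \x mu)%E.-integrable setT Phi.
  apply/(integrable21ltyP mu mu mPhi).
  apply: (@le_lt_trans _ _ (\int[mu]_(z in `[0%R, u]) (M%:E * C))%E); last first.
    rewrite -(fineK Cfin) -EFinM integral_cst//= lebesgue_measure_itv/=.
    by case: ifP => _; rewrite -?EFinB -?EFinM ?mule0 ltry.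
  rewrite [leRHS]integral_mkcond; apply: ge0_le_integral => //.
  - by move=> z _; exact: integral_ge0.
  - have : measurable_fun setT (fubini_G mu (abse \o Phi)).
      apply: measurable_fun_fubini_tonelli_G; last by move=> z; exact: abse_ge0.
      exact: measurableT_comp.
    by [].
  - by apply/(measurable_restrictT _ _).1.
  move=> z _.
  have -> : (((fun=> (M%:E * C)%E) : R -> \bar R) \_ `[0, u]) z =
            ((M * \1_`[0, u] z)%:E * C)%E.
    by rewrite patchE indicE; case: ifPn => _; rewrite ?mulr1 ?mulr0 ?mul0e.
  rewrite /C -(@ge0_integral_shift z (fun x => `|(ph x)%:E|%E))//; last first.
    by apply: measurableT_comp => //; exact/measurable_EFinP.
  rewrite -ge0_integralZl//; last 2 first.
  - by apply: measurableT_comp => //; apply/measurable_EFinP; exact: mphz.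
  - by rewrite lee_fin mulr_ge0// indicE.
  apply: ge0_le_integral => //.
  - apply: measurableT_comp => //; apply/measurable_EFinP => /=.
    apply: measurable_funM; last exact: measurable_cst.
    by apply: measurable_funM; [exact: mphz|exact: mi].
  - apply: measurable_funeM; apply: measurableT_comp => //; apply/measurable_EFinP.
    exact: mphz.
  move=> x _; rewrite lee_fin !normrM mulrC ler_pM ?mulr_ge0//.
  by rewrite -[leRHS]mulr1 ler_wpM2l// indicE; case: (_ \in _); rewrite ?normr1 ?normr0.
have LE x : (\int[mu]_z Phi (x, z) = ((EFin \o conv g p) \_ `[0%R, u]) x)%E.
  rewrite patchE /Phi /=; case: ifPn => [|xu]; last first.
    rewrite indicE (negbTE xu); apply: integral0_eq => ? _.
    by rewrite mulr0 mul0r.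
  rewrite indicE => xu; rewrite xu; move: xu; rewrite inE/= in_itv/= => xu.
  rewrite convC; last by apply: conv_integrable.
  rewrite /conv /Rintegral fineK; last first.
    by apply/integrable_fin_num/conv_integrableC.
  rewrite [RHS]integral_mkcond; apply: eq_integral => y _.
  rewrite /ph /gh !patchE !mem_itv /= !in_itv/=.
  case: ifPn => h1; case: ifPn => h2; case: ifPn => h3; rewrite ?mulr1 ?mul0r ?mulr0//; exfalso; lra.
have RE z : (\int[mu]_x Phi (x, z) =
    ((fun z => ((\int[mu]_(x in `[0, u - z]) p x)%R * g z)%:E) \_ `[0%R, u]) z)%E.
  rewrite patchE /Phi /=; case: ifPn => [|zu]; last first.
    by apply: integral0_eq => ? _; rewrite /gh patchE (negbTE zu) mulr0.
  move=> zu; have -> : gh z = g z by rewrite /gh patchE zu.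
  move: zu; rewrite mem_itv in_itv/= => zu.
  have iJ : mu.-integrable setT ((EFin \o p) \_ `[0, u - z]).
    by have /integrable_mkcond := ip (u - z); exact.
  rewrite EFinM /Rintegral fineK; last exact/integrable_fin_num.
  rewrite [X in (X * _)%E]integral_mkcond -(integral_shift z iJ) muleC -integralZl//; last first.
    exact: (integrable_shift z iJ).
  apply: eq_integral => x _; rewrite muleC EFinM; congr (_ * _)%E.
  rewrite /ph !patchE !indicE !mem_itv /= !in_itv/=.
  have [h1|h1] := boolP (0 <= x - z <= u); have [h2|h2] := boolP (0 <= x <= u);
    have [h3|h3] := boolP (0 <= x - z <= u - z);
    rewrite /= ?mulr1 ?mul0r ?mulr0//; exfalso; move: h1 h2 h3; lra.
have := Fubini iPhi.
have -> : (\int[mu]_x \int[mu]_z Phi (x, z) =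
           \int[mu]_(x in `[0%R, u]) (conv g p x)%:E)%E.
  by rewrite [RHS]integral_mkcond; apply: eq_integral => x _; rewrite LE.
have -> : (\int[mu]_z \int[mu]_x Phi (x, z) = \int[mu]_(z in `[0%R, u])
    ((\int[mu]_(x in `[0, u - z]) p x)%R * g z)%:E)%E.
  by rewrite [RHS]integral_mkcond; apply: eq_integral => z _; rewrite RE.
by move=> h; rewrite /Rintegral h.
Qed.

End convolution_derivative.

(** * Differentiating the renewal equation *)

Section renewal_calculus.
Context {R : realType}.
Local Notation mu := (@lebesgue_measure R).
Implicit Types (p q f g h w : R -> R) (u x y z M : R).

Lemma Rint_primitive_dpos p : locint p ->
  (forall u, 0 < u -> {for u, continuous p}) ->
  dpos (fun u => \int[mu]_(z in `[0, u]) p z) p.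
Proof.
move=> ip cp u u0.
have u1 : u < u + 1 by rewrite ltrDl.
have [du dE] := continuous_FTC1_closed u1 (ip (u + 1)) u0 (cp u u0).
by rewrite -[X in is_derive _ _ _ X]dE derive1E; exact/derivableP.
Qed.

(** The function [p] may be unbounded near 0: [g] minus the primitive of [p] has zero derivative on
    the open half-line and is continuous at 0, hence is constant. *)
Lemma primitiveE g p : C0 g -> locint p ->
  (forall u, 0 < u -> {for u, continuous p}) -> dpos g p ->
  forall x, 0 <= x -> g x = g 0 + \int[mu]_(z in `[0, x]) p z.
Proof.
move=> cg ip cp gp x x0.
pose P u := \int[mu]_(z in `[0, u]) p z.
have cP : C0 P := Rint_primitive_C0 ip.
have : `|(g x - P x) - (g 0 - P 0)| <= 0 - 0.
  apply: (@le_increment R (fun x => g x - P x) (fun=> 0) (fun x => p x - p x) (fun=> 0)) => //.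
  - by apply: C0_within => //; apply: C0D => //; exact: C0N.
  - by apply: continuous_subspaceT => y; exact: cvg_cst.
  - move=> y /andP[y0 _]; apply: is_deriveB; first exact: gp.
    exact: Rint_primitive_dpos.
  - by move=> y _ /=; rewrite subrr normr0.
have -> : P 0 = 0 by rewrite /P set_itv1 Rintegral_set1.
by rewrite !subr0 normr_le0 /P => /eqP; lra.
Qed.

(** Inserting the formula for [a (u - z)] and exchanging integrals exhibits [conv a b] as the
    primitive of the continuous function [a 0 * b + conv b p]. Only [a] is differentiated; [b] is
    merely continuous. *)
Lemma conv_dpos (a p b : R -> R) : C0 b -> locint p ->
  (forall x, 0 <= x -> a x = a 0 + \int[mu]_(z in `[0, x]) p z) ->
  dpos (conv a b) (fun u => a 0 * b u + conv b p u).
Proof.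
move=> cb ip aE.
pose q u := a 0 * b u + conv b p u.
have cq : C0 q by apply: C0D; [exact: C0Z|exact: conv_continuous].
apply: (@dpos_eq _ (fun u => \int[mu]_(z in `[0, u]) q z)).
  move=> u u0.
  have ib := C0_locint cb u.
  have icb := C0_locint (conv_continuous cb ip) u.
  have iab : mu.-integrable `[0, u] (EFin \o (fun x => a 0 * b x)%R).
    exact: (C0_locint (C0Z (c := a 0) cb) u).
  rewrite RintegralD// Rint_conv// ?ltW// -RintegralD//; last first.
    exact: (conv_integrable (Rint_primitive_C0 ip)).
  apply: eq_Rintegral => z; rewrite inE/= in_itv/= => zu.
  by rewrite (aE (u - z)) ?mulrDl//; lra.
by apply: Rint_primitive_dpos (C0_locint cq) _ => u u0; exact: C0_at.
Qed.

Variables (phi : R) (f f1 : R -> R).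
Hypotheses (cf : C0 f) (cf1 : C0 f1) (df : dpos f f1).

Lemma conv_swap h : C0 h -> forall u, conv h f u = conv f h u.
Proof. by move=> ch u; rewrite convC//; apply: conv_integrable => //; exact: C0_locint. Qed.

Let fE := primitiveE cf (C0_locint cf1) (fun u => @C0_at _ _ u cf1) df.

Lemma is_deriveD1 (g1 g2 : R -> R) d1 d2 u : is_derive u 1 g1 d1 -> is_derive u 1 g2 d2 ->
  is_derive u 1 (fun x => g1 x + g2 x) (d1 + d2).
Proof. by move=> ? ?; exact: is_deriveD. Qed.

Lemma is_deriveZ1 (g1 : R -> R) c d1 u : is_derive u 1 g1 d1 ->
  is_derive u 1 (fun x => c * g1 x) (c * d1).
Proof. by move=> ?; exact: is_deriveZ. Qed.

Lemma renewal_dpos h w w' : C0 h ->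
  (forall u, 0 <= u -> h u = phi * conv h f u + w u) -> dpos w w' ->
  dpos h (fun u => phi * (f 0 * h u + conv h f1 u) + w' u).
Proof.
move=> ch hE dw; apply: (@dpos_eq _ (fun u => phi * conv f h u + w u)).
  by move=> u u0; rewrite hE ?ltW// conv_swap.
move=> u u0; apply: is_deriveD1 (dw u u0); apply: is_deriveZ1.
exact: (conv_dpos ch (C0_locint cf1) fE).
Qed.

(** The second derivative also falls on the density, so [f2] only has to be locally integrable at 0;
    [f1 0] is the boundary term this produces. *)
Lemma renewal_dpos2 f2 h h' w' w'' : C0 h -> dpos h h' ->
  dpos f1 f2 -> locint f2 -> (forall u, 0 < u -> {for u, continuous f2}) ->
  dpos w' w'' ->
  dpos (fun u => phi * (f 0 * h u + conv h f1 u) + w' u)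
       (fun u => phi * (f 0 * h' u + (f1 0 * h u + conv h f2 u)) + w'' u).
Proof.
move=> ch dh df1 if2 cf2 dw.
have f1E := primitiveE cf1 if2 cf2 df1.
apply: (@dpos_eq _ (fun u => phi * (f 0 * h u + conv f1 h u) + w' u)).
  move=> u u0; rewrite [conv f1 h u]convC//.
  by apply: conv_integrable => //; exact: C0_locint.
move=> u u0; apply: is_deriveD1 (dw u u0); apply: is_deriveZ1.
apply: is_deriveD1; first exact/is_deriveZ1/dh.
exact: (conv_dpos ch if2 f1E).
Qed.

(** The order of the two differentiations matters. Putting the derivative on [f] shows that [h']
    exists and is continuous up to 0; only then can it be put on [h], and equating the two
    expressions gives the new renewal equation. At u = 0 both convolutions vanish. *)
Lemma renewal_derive h w w' : C0 h ->
  (forall u, 0 <= u -> h u = phi * conv h f u + w u) -> dpos w w' -> C0 w' ->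
  let h' u := phi * (f 0 * h u + conv h f1 u) + w' u in
  C0 h' /\ forall u, 0 <= u ->
    h' u = phi * conv h' f u + (phi * h 0 * f u + w' u).
Proof.
move=> ch hE dw cw h'.
have ch' : C0 h'.
  apply: C0D => //; apply: C0Z; apply: C0D; first exact: C0Z.
  exact/conv_continuous/C0_locint.
split => // u; rewrite le_eqVlt => /predU1P[<-|u0].
  by rewrite /h' !conv0; ring.
have dh : dpos h h' := renewal_dpos ch hE dw.
have h'E := primitiveE ch (C0_locint ch') (fun u => @C0_at _ _ u ch') dh.
have dh2 : dpos h (fun u => phi * (h 0 * f u + conv f h' u) + w' u).
  apply: (@dpos_eq _ (fun u => phi * conv h f u + w u)).
    by move=> x x0; rewrite hE ?ltW.
  move=> x x0; apply: is_deriveD1 (dw x x0); apply: is_deriveZ1.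
  exact: (conv_dpos cf (C0_locint ch') h'E).
rewrite -(dpos_derive1 dh u0) (dpos_derive1 dh2 u0) (conv_swap ch').
by ring.
Qed.

End renewal_calculus.

(** * Bounds for renewal equations *)

Section renewal_bounds.
Context {R : realType}.
Local Notation mu := (@lebesgue_measure R).
Implicit Types (p q f g h w : R -> R) (u x y z M : R).

Lemma C0_norm g : C0 g -> C0 (fun x => `|g x|).
Proof.
move=> /C0_clamp cg; apply/C0_clamp => x.
by apply: (@continuous_comp _ _ _ (fun x => g (Num.max 0 x)) Num.norm);
  [exact: cg|exact: norm_continuous].
Qed.

Lemma C0_id : C0 (@id R).
Proof. by apply: continuous_C0 => x. Qed.

Lemma C0X g n : C0 g -> C0 (fun x => g x ^+ n).
Proof.
move=> cg; elim: n => [|n IH]; first exact: C0_cst.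
by under eq_fun do rewrite exprS; exact: C0M.
Qed.

Lemma C0_max g (c : R) : C0 g -> 0 <= c ->
  exists2 x, 0 <= x <= c & forall y, 0 <= y <= c -> g y <= g x.
Proof.
move=> cg c0.
have [||x xc xmax] := @compact_EVT_max _ R g `[0, c] _ (@segment_compact R 0 c).
- by exists 0 => /=; rewrite in_itv/= lexx.
- exact: C0_within.
exists x; first by move: xc; rewrite inE/= in_itv.
by move=> y yc; apply: xmax; rewrite inE/= in_itv.
Qed.

Variables (phi : R) (f : R -> R).
Hypotheses (phi0 : 0 < phi) (phi1 : phi < 1) (cf : C0 f).
Hypothesis f0 : forall u, 0 <= u -> 0 <= f u.
Hypothesis F1 : forall u, 0 <= u -> \int[mu]_(z in `[0, u]) f z <= 1.

(** At a point x of [0, u] where |h| is largest the equation gives |h x| <= phi |h x| + W, and phi <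
    1 absorbs the first term. The resulting bound does not depend on u. *)
Lemma renewal_bounded h w W : C0 h ->
  (forall u, 0 <= u -> h u = phi * conv h f u + w u) ->
  (forall u, 0 <= u -> `|w u| <= W) ->
  forall u, 0 <= u -> `|h u| <= W / (1 - phi).
Proof.
move=> ch hE wW u u0.
have [x /andP[x0 xu] xmax] := C0_max (C0_norm ch) u0.
apply: le_trans (xmax u _) _; first by rewrite u0 lexx.
rewrite ler_pdivlMr ?subr_gt0// mulrBr mulr1 lerBlDr.
rewrite {1}hE//; apply: le_trans (ler_normD _ _) _.
rewrite addrC lerD ?wW// normrM (gtr0_norm phi0) mulrC ler_wpM2r ?(ltW phi0)//.
have ifx := C0_locint cf x.
apply: (@le_trans _ _ (`|h x| * \int[mu]_(z in `[0, x]) `|f z|)).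
  apply: le_conv => //; first exact: conv_integrable.
  by move=> y /andP[y0 yx]; apply: xmax; rewrite y0 (le_trans yx).
rewrite -[leRHS]mulr1 ler_wpM2l// (le_trans _ (F1 x0))//.
rewrite le_eqVlt; apply/orP; left; apply/eqP.
by apply: eq_Rintegral => z; rewrite inE/= in_itv/= => /andP[z0 _]; rewrite ger0_norm ?f0.
Qed.

Lemma le_conv_dom h p u g : 0 <= u -> C0 h -> locint p ->
  mu.-integrable `[0, u] (EFin \o g) ->
  (forall y, 0 <= y <= u -> u ^+ 2 * `|h (u - y) * p y| <= g y) ->
  u ^+ 2 * `|conv h p u| <= \int[mu]_(y in `[0, u]) g y.
Proof.
move=> u0 ch ip ig hg.
have ihp := conv_integrable ch (ip u).
apply: (@le_trans _ _ (u ^+ 2 * \int[mu]_(z in `[0, u]) `|h (u - z) * p z|)).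
  by rewrite ler_wpM2l ?sqr_ge0//; exact: le_normr_Rintegral.
have inhp := integrable_norm ihp.
rewrite -RintegralZl//; apply: le_Rintegral => //.
exact: (@integrableZl _ _ _ mu _ _ (u ^+ 2) (EFin \o (fun z => `|h (u - z) * p z|)%R)).
Qed.

(* [u^2 <= (1 + e) (u - y)^2 + (1 + 1 / e) y^2], with [phi (1 + e) = (1 + phi) / 2] *)
Lemma renewal_weighted_bounded h w B W C : C0 h ->
  (forall u, 0 <= u -> h u = phi * conv h f u + w u) ->
  (forall u, 0 <= u -> `|h u| <= B) ->
  (forall u, 0 <= u -> u ^+ 2 * `|w u| <= W) ->
  (forall u, 0 <= u -> \int[mu]_(y in `[0, u]) (y ^+ 2 * f y) <= C) ->
  exists S, forall u, 0 <= u -> u ^+ 2 * `|h u| <= S.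
Proof.
move=> ch hE hB wW fC.
pose e := (1 - phi) / (2 * phi).
have e0 : 0 < e by rewrite divr_gt0 ?mulr_gt0// subr_gt0.
have phie : phi * (1 + e) = (1 + phi) / 2.
  by rewrite /e; field; rewrite gt_eqF.
(* At a maximum point of u^2 |h u| the term phi (1 + e) S moves to the left-hand side, which leaves
   S times 1 - (1 + phi) / 2, the denominator here. *)
exists ((phi * (1 + e^-1) * B * C + W) / ((1 - phi) / 2)) => u u0.
have cS : C0 (fun u => u ^+ 2 * `|h u|).
  by apply: C0M; [exact/C0X/C0_id|exact: C0_norm].
have [x /andP[x0 xu] xmax] := C0_max cS u0.
apply: le_trans (xmax u _) _; first by rewrite u0 lexx.
rewrite ler_pdivlMr ?divr_gt0 ?subr_gt0//.
set S := x ^+ 2 * `|h x|.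
have S0 : 0 <= S by rewrite mulr_ge0 ?sqr_ge0.
have B0 : 0 <= B by apply: le_trans (hB 0 _).
pose g y := (1 + e) * S * f y + (1 + e^-1) * B * (y ^+ 2 * f y).
have cyf : C0 (fun y => y ^+ 2 * f y) by apply: C0M => //; exact/C0X/C0_id.
have ig : mu.-integrable `[0, x] (EFin \o g).
  by apply: C0_locint; apply: C0D; exact: C0Z.
have : x ^+ 2 * `|conv h f x| <= \int[mu]_(y in `[0, x]) g y.
  apply: le_conv_dom => //; first exact: C0_locint.
  move=> y /andP[y0 yx].
  have fy0 := f0 y0.
  have Sy : (x - y) ^+ 2 * `|h (x - y)| <= S by apply: xmax; lra.
  have By : `|h (x - y)| <= B by apply: hB; lra.
  have hy0 := normr_ge0 (h (x - y)).
  have xe : x ^+ 2 <= (1 + e) * (x - y) ^+ 2 + (1 + e^-1) * y ^+ 2.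
    have ee : e * e^-1 = 1 by rewrite mulfV ?gt_eqF.
    have ei0 : 0 < e^-1 by rewrite invr_gt0.
    (* With x = (x - y) + y, this square is exactly the difference of the two sides of [xe]. *)
    have : 0 <= e * (x - y - e^-1 * y) ^+ 2 by rewrite mulr_ge0 ?sqr_ge0 ?ltW.
    rewrite (_ : e * _ = e * (x - y) ^+ 2 - 2 * (e * e^-1) * (x - y) * y + (e * e^-1) * e^-1 * y ^+ 2); last by ring.
    by rewrite ee; lra.
  rewrite normrM (ger0_norm fy0) mulrA.
  rewrite /g [X in _ <= _ + X]mulrA -mulrDl ler_wpM2r//.
  apply: le_trans (ler_wpM2r hy0 xe) _.
  rewrite mulrDl lerD//.
    by rewrite -mulrA ler_wpM2l// addr_ge0 ?ltW.
  rewrite -[X in X <= _]mulrA -[X in _ <= X]mulrA ler_wpM2l//; first by rewrite addr_ge0 ?invr_ge0 ?ltW.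
  by rewrite mulrC ler_wpM2r ?sqr_ge0.
rewrite RintegralD//; last 2 first.
- by apply: (C0_locint (C0Z (c := (1 + e) * S) cf)).
- by apply: (C0_locint (C0Z (c := (1 + e^-1) * B) cyf)).
rewrite !RintegralZl//; [|exact: (C0_locint cyf)|exact: (C0_locint cf)] => Hg.
have SE : S <= phi * (x ^+ 2 * `|conv h f x|) + x ^+ 2 * `|w x|.
  rewrite /S hE// mulrCA -mulrDr ler_wpM2l ?sqr_ge0//.
  by apply: le_trans (ler_normD _ _) _; rewrite normrM (gtr0_norm phi0).
have wx := wW _ x0.
have h1 : (1 + e) * S * \int[mu]_(y in `[0, x]) f y <= (1 + e) * S.
  by rewrite -[leRHS]mulr1 ler_wpM2l ?F1// mulr_ge0// addr_ge0 ?ltW.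
have h2 : (1 + e^-1) * B * \int[mu]_(y in `[0, x]) (y ^+ 2 * f y) <= (1 + e^-1) * B * C.
  by rewrite ler_wpM2l ?fC// mulr_ge0// addr_ge0 ?invr_ge0 ?ltW.
have h3 : phi * (x ^+ 2 * `|conv h f x|) <= phi * ((1 + e) * S + (1 + e^-1) * B * C).
  by rewrite ler_wpM2l ?(ltW phi0)//; lra.
have h4 : phi * ((1 + e) * S + (1 + e^-1) * B * C) =
  (1 + phi) / 2 * S + phi * (1 + e^-1) * B * C.
  by rewrite -phie; ring.
by lra.
Qed.

(** Both weighted bounds on [h] are already known, so nothing has to be absorbed and the splitting
    of u^2 with e = 1 suffices; [p] may change sign. *)
Lemma conv_weighted_bounded h p H0 H2 I0 I2 : C0 h -> locint p ->
  (forall u, mu.-integrable `[0, u] (fun y => (y ^+ 2 * `|p y|)%:E)) ->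
  (forall u, 0 <= u -> `|h u| <= H0) ->
  (forall u, 0 <= u -> u ^+ 2 * `|h u| <= H2) ->
  (forall u, 0 <= u -> \int[mu]_(y in `[0, u]) `|p y| <= I0) ->
  (forall u, 0 <= u -> \int[mu]_(y in `[0, u]) (y ^+ 2 * `|p y|) <= I2) ->
  forall u, 0 <= u -> u ^+ 2 * `|conv h p u| <= 2 * (H2 * I0 + H0 * I2).
Proof.
move=> ch ip ip2 hH0 hH2 pI0 pI2 u u0.
have H00 : 0 <= H0 by apply: le_trans (hH0 0 _).
have H20 : 0 <= H2.
  by apply: le_trans (hH2 0 _) => //; rewrite mulr_ge0 ?sqr_ge0.
pose g y := 2 * H2 * `|p y| + 2 * H0 * (y ^+ 2 * `|p y|).
have inp := integrable_norm (ip u).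
have i1 : mu.-integrable `[0, u] (fun y => (2 * H2 * `|p y|)%:E).
  exact: (@integrableZl _ _ _ mu _ _ (2 * H2) (EFin \o (Num.norm \o p))).
have i2 : mu.-integrable `[0, u] (fun y => (2 * H0 * (y ^+ 2 * `|p y|))%:E).
  exact: (@integrableZl _ _ _ mu _ _ (2 * H0) (fun y => (y ^+ 2 * `|p y|)%:E)).
apply: (@le_trans _ _ (\int[mu]_(y in `[0, u]) g y)).
  apply: le_conv_dom => //; first exact: (@integrableD _ _ _ mu _ _ _ _ i1 i2).
  move=> y yu; rewrite normrM.
  have hy2 : (u - y) ^+ 2 * `|h (u - y)| <= H2 by apply: hH2; lra.
  have hy0 : `|h (u - y)| <= H0 by apply: hH0; lra.
  rewrite mulrA /g [X in _ <= _ + X]mulrA -mulrDl ler_wpM2r//.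
  have hn := normr_ge0 (h (u - y)).
  have : u ^+ 2 <= 2 * (u - y) ^+ 2 + 2 * y ^+ 2.
    by have := sqr_ge0 (u - 2 * y); rewrite -subr_ge0 => ?; lra.
  move/(ler_wpM2r hn)/le_trans; apply.
  rewrite mulrDl lerD//; first by rewrite -[X in X <= _]mulrA ler_wpM2l.
  rewrite -[X in X <= _]mulrA -[X in _ <= X]mulrA ler_wpM2l//.
  by rewrite mulrC ler_wpM2r// sqr_ge0.
rewrite RintegralD// !RintegralZl//.
have := ler_wpM2l H20 (pI0 u u0); have := ler_wpM2l H00 (pI2 u u0); lra.
Qed.

End renewal_bounds.

(** * The density of [Z] *)

Section density.
Context {R : realType} d (Omega : measurableType d) (P : probability Omega R).
Variable Z : {RV P >-> R}.
Local Notation mu := (@lebesgue_measure R).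

Let F u := fine (cdf Z u).

Lemma is_derive_ge0 (g : R -> R) (u dg : R) : {homo g : x y / x <= y} ->
  is_derive u 1 g dg -> 0 <= dg.
Proof.
move=> ng du; rewrite -(@derive_val _ _ _ _ _ _ _ du).
apply: limr_ge; first by have [] := du.
near=> h => /=; rewrite scaler1.
have h0 : h != 0 by near: h; exact: nbhs_dnbhs_neq.
have [hp|hn|h00] := ltgtP 0 h; last by rewrite h00 eqxx in h0.
  by rewrite mulr_ge0 ?invr_ge0 ?(ltW hp)// subr_ge0 ng// lerDr ltW.
by rewrite mulr_le0// ?invr_le0 ?(ltW hn)// subr_le0 ng// gerDr ltW.
Unshelve. all: by end_near. Qed.

Lemma cdf_fin_num u : cdf Z u \is a fin_num.
Proof. exact: fin_num_measure. Qed.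

Lemma fine_cdf_homo : {homo F : x y / x <= y}.
Proof. by move=> x y xy; rewrite fine_le ?cdf_fin_num// cdf_nondecreasing. Qed.

Lemma fine_cdf_le1 u : F u <= 1.
Proof. by rewrite -lee_fin fineK ?cdf_fin_num// cdf_le1. Qed.

Lemma prob_itv (a b : R) : a <= b ->
  P (Z @^-1` `]a, b]) = (F b - F a)%:E.
Proof.
move=> ab; rewrite EFinB !fineK ?cdf_fin_num// /cdf /distribution /pushforward.
have mZ (A : set R) : measurable A -> measurable (Z @^-1` A).
  by move=> mA; rewrite -[X in measurable X]setTI; exact: measurable_funP.
have ZE : Z @^-1` `]-oo, b] = Z @^-1` `]-oo, a] `|` Z @^-1` `]a, b].
  apply/seteqP; split => w /=; rewrite !in_itv/=.
    by move=> Zb; have [Za|Za] := leP (Z w) a; [left|right; rewrite Zb].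
  by move=> [/le_trans->//|/andP[]].
have PE : P (Z @^-1` `]-oo, b]) = (P (Z @^-1` `]-oo, a]) + P (Z @^-1` `]a, b]))%E.
  rewrite ZE measureU//; [exact: mZ|exact: mZ|].
  rewrite -subset0 => w [] /=; rewrite !in_itv/= => h /andP[].
  by rewrite ltNge h.
have fa : P (Z @^-1` `]-oo, a]) \is a fin_num by exact: (cdf_fin_num a).
rewrite PE; move: fa; generalize (P (Z @^-1` `]-oo, a])) => x fx.
by rewrite [X in _ = (X - _)%E]addeC addeK.
Qed.

Hypotheses (Z0 : forall w, 0 <= Z w) (VZ : ('V_P[Z] < +oo)%E).

(** The bound (Z + 1)^2 <= 2 (Z - c)^2 + 2 (c + 1)^2 holds for every real c, so it applies to the
    centre used by the variance. The shift by 1 lets the integrand dominate the square of the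
    ceiling of Z. *)
Lemma second_moment : (\int[P]_w (((Z w + 1) ^+ 2)%:E) < +oo)%E.
Proof.
move: VZ; rewrite /variance covariance.unlock expectation.unlock.
set c := fine _ => Vc.
have mZ : measurable_fun setT (Z : Omega -> R) by exact: measurable_funP.
apply: (@le_lt_trans _ _ (\int[P]_w (2%:E * ((Z w - c) * (Z w - c))%:E +
   (2 * (c + 1) ^+ 2)%:E))%E).
  apply: ge0_le_integral => //.
  - by move=> w _; rewrite lee_fin sqr_ge0.
  - apply/measurable_EFinP; apply: measurable_funX.
    exact: measurable_funD.
  - apply: emeasurable_funD => //; apply: measurable_funeM.
    by apply/measurable_EFinP; apply: measurable_funM; exact: measurable_funB.
  - move=> w _; rewrite -EFinM -EFinD lee_fin -subr_ge0.
    rewrite (_ : _ - _ = (Z w - c - (c + 1)) ^+ 2); last by ring.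
    exact: sqr_ge0.
rewrite ge0_integralD//=; last 3 first.
- by move=> w _; rewrite mule_ge0// lee_fin -expr2 sqr_ge0.
- apply: measurable_funeM.
  by apply/measurable_EFinP; apply: measurable_funM; exact: measurable_funB.
- by move=> w _; rewrite lee_fin mulr_ge0// sqr_ge0.
rewrite integral_cst//.
rewrite ge0_integralZl//; last 2 first.
- by apply/measurable_EFinP; apply: measurable_funM; exact: measurable_funB.
- by move=> w _; rewrite lee_fin -expr2 sqr_ge0.
rewrite lte_add_pinfty ?lte_mul_pinfty//.
- by rewrite lee_fin mulr_ge0// sqr_ge0.
- by rewrite ltey_eq fin_num_measure.
Qed.

(** The squared ceiling of [Z w] where 0 < Z <= N, and 0 elsewhere. *)
Let step (N : nat) (w : Omega) : R :=
  \sum_(0 <= i < N) i.+1%:R ^+ 2 * \1_(Z @^-1` `]i%:R, i.+1%:R]) w.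

Let step_le N w : step N w <= if Z w <= N%:R then (Z w + 1) ^+ 2 else 0.
Proof.
elim: N => [|N IH]; first by rewrite /step big_geq//; case: ifP => // _; exact: sqr_ge0.
rewrite /step big_nat_recr//= -/(step N w) indicE.
have [ZN|NZ] := leP (Z w) N%:R.
  rewrite ifT; last by rewrite (le_trans ZN)// ler_nat.
  rewrite memNset ?mulr0 ?addr0/=; last by rewrite in_itv/= ltNge ZN.
  by move: IH; rewrite ZN.
move: IH; rewrite (leNgt (Z w)) NZ/= => IH.
have [ZN1|NZ1] := leP (Z w) N.+1%:R; last first.
  rewrite memNset ?mulr0 ?addr0//= in_itv/= => /andP[_].
  by rewrite leNgt NZ1.
rewrite mem_set/=; last by rewrite in_itv/= NZ.
rewrite mulr1 -[leRHS]add0r lerD// ler_sqr ?nnegrE ?addr_ge0//.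
by rewrite -natr1 lerD2r ltW.
Qed.

(** The sum is the expectation of [step N]. It is the bridge from the law of Z to the density: the
    values of F at integers appear on both sides. *)
Lemma sum_moment : exists C : R, forall N : nat,
  \sum_(0 <= i < N) i.+1%:R ^+ 2 * (F i.+1%:R - F i%:R) <= C.
Proof.
have mZ (A : set R) : measurable A -> measurable (Z @^-1` A).
  by move=> mA; rewrite -[X in measurable X]setTI; exact: measurable_funP.
exists (fine (\int[P]_w (((Z w + 1) ^+ 2)%:E))) => N.
rewrite -lee_fin fineK; last first.
  by rewrite ge0_fin_numE ?second_moment// integral_ge0// => w _; rewrite lee_fin sqr_ge0.
rewrite -sumEFin.
under eq_bigr => i _ do rewrite EFinM -prob_itv ?ler_nat//.
have mstep i : measurable_fun setT (fun w => (i.+1%:R ^+ 2 * \1_(Z @^-1` `]i%:R, i.+1%:R]) w : R)).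
  by apply: measurable_funM => //; apply: measurable_indic; exact: mZ.
apply: (@le_trans _ _ (\int[P]_w (step N w)%:E)%E).
  rewrite /step; under [in leRHS]eq_integral do rewrite -sumEFin.
  rewrite ge0_integral_sum//; last first.
    by move=> i; apply/measurable_EFinP; exact: mstep.
  apply: lee_sum => i _; under eq_integral do rewrite EFinM.
  rewrite ge0_integralZl//; last first.
    by apply/measurable_EFinP; apply: measurable_indic; exact: mZ.
  by rewrite integral_indic ?setIT//; exact: mZ.
apply: ge0_le_integral => //.
- move=> w _; rewrite lee_fin; apply: sumr_ge0 => i _.
  by rewrite mulr_ge0 ?sqr_ge0// indicE.
- by apply/measurable_EFinP; apply: measurable_sum => i; exact: mstep.
- apply/measurable_EFinP; apply: measurable_funX; apply: measurable_funD => //.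
- move=> w _; rewrite lee_fin (le_trans (step_le N w))//.
  by case: ifP => // _; exact: sqr_ge0.
Qed.

Hypotheses (F0 : F 0 = 0) (cnF : Cn0 2 F).
Let f := dern 1 F.

Lemma density_dpos : dpos F f.
Proof.
have := Cn_dpos (Cn0_Cn cnF) (ltn0Sn 1).
by apply: dpos_eq => u u0; rewrite dern_gt0.
Qed.

Lemma density_C0 : C0 f. Proof. exact: (Cn0_C0 cnF). Qed.

Lemma density_ge0 u : 0 <= u -> 0 <= f u.
Proof.
have pos v : 0 < v -> 0 <= f v.
  by move=> v0; exact: is_derive_ge0 fine_cdf_homo (density_dpos v0).
rewrite le_eqVlt => /predU1P[<-|]; last exact: pos.
have /C0P[_ cf] := density_C0.
by apply: (cvgr_to_ge cf); near=> x; exact: pos.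
Unshelve. all: by end_near. Qed.

Lemma density_integral u : 0 <= u -> \int[mu]_(z in `[0, u]) f z = F u.
Proof.
move=> u0; have cf := density_C0.
have := primitiveE (Cn_C0 (Cn0_Cn cnF)) (C0_locint cf)
  (fun v => @C0_at _ _ v cf) density_dpos u0.
by rewrite F0 add0r => ->.
Qed.

Lemma density_le1 u : 0 <= u -> \int[mu]_(z in `[0, u]) f z <= 1.
Proof. by move=> u0; rewrite density_integral// fine_cdf_le1. Qed.

(** On [N, N + 1] one has y^2 f <= (N + 1)^2 f, so each increment of the moment integral [G] is at
    most (N + 1)^2 times that of F; monotonicity of [G] reaches every u. *)
Lemma density_moment2 : exists C : R, forall u, 0 <= u ->
  \int[mu]_(y in `[0, u]) (y ^+ 2 * f y) <= C.
Proof.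
have [C hC] := sum_moment; exists C => u u0.
have cyf : C0 (fun y => y ^+ 2 * f y).
  by apply: C0M; [exact/C0X/C0_id|exact: density_C0].
pose G x := \int[mu]_(y in `[0, x]) (y ^+ 2 * f y).
have cG : C0 G by exact: Rint_primitive_C0 (C0_locint cyf).
have dG : dpos G (fun y => y ^+ 2 * f y).
  by apply: Rint_primitive_dpos (C0_locint cyf) _ => y; exact: C0_at.
have cF : C0 F := Cn_C0 (Cn0_Cn cnF).
have GN (N : nat) : G N%:R <= \sum_(0 <= i < N) i.+1%:R ^+ 2 * (F i.+1%:R - F i%:R).
  elim: N => [|N IH]; first by rewrite big_geq// /G set_itv1 Rintegral_set1.
  rewrite big_nat_recr//=.
  suff : `|G N.+1%:R - G N%:R| <= N.+1%:R ^+ 2 * F N.+1%:R - N.+1%:R ^+ 2 * F N%:R.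
    by move=> /ler_normlW; lra.
  apply: (@le_increment R G (fun y => N.+1%:R ^+ 2 * F y) (fun y => y ^+ 2 * f y)
    (fun y => N.+1%:R ^+ 2 * f y)).
  - by rewrite ler_nat.
  - exact: C0_within.
  - by apply: C0_within => //; exact: C0Z.
  - by move=> x /andP[Nx _]; apply: dG; exact: le_lt_trans Nx.
  - move=> x /andP[Nx _]; apply: is_deriveZ1; apply: density_dpos.
    exact: le_lt_trans Nx.
  - move=> x /andP[Nx xN].
    have x0 : 0 < x by exact: le_lt_trans Nx.
    have fx := density_ge0 (ltW x0).
    rewrite ger0_norm; last exact: mulr_ge0 (sqr_ge0 _) fx.
    by rewrite ler_wpM2r// ler_sqr ?nnegrE ?ltW.
have [N uN] : exists N : nat, u <= N%:R.
  by exists (Num.truncn u).+1; rewrite ltW// truncnS_gt.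
apply: le_trans (le_trans (GN N) (hC N)).
suff : `|G N%:R - G u| <= G N%:R - G u.
  by rewrite -/(G u); have := normr_ge0 (G N%:R - G u); lra.
apply: (@le_increment R G G (fun y => y ^+ 2 * f y) (fun y => y ^+ 2 * f y)) => //.
- exact: C0_within.
- exact: C0_within.
- by move=> x /andP[ux _]; apply: dG; exact: le_lt_trans ux.
- by move=> x /andP[ux _]; apply: dG; exact: le_lt_trans ux.
- move=> x /andP[ux _]; rewrite ger0_norm// mulr_ge0 ?sqr_ge0// density_ge0//.
  exact: le_trans (ltW ux).
Qed.

(** If f vanished on the open half-line, F would be 0 there, against its limit 1 at infinity. The
    interval is where division by f recovers [m] from the integrand of the renewal equation. *)
Lemma density_neq0 : exists a b : R,
  [/\ 0 < a, a < b & forall x, a < x < b -> f x != 0].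
Proof.
have [x x0 fx] : exists2 x, 0 < x & f x != 0.
  apply: contrapT => nx.
  have f_eq0 x : 0 < x -> f x = 0.
    by move=> x0; apply: contrapT => /eqP fx; apply: nx; exists x.
  have F_eq0 x : 0 <= x -> F x = 0.
    move=> x0; rewrite -density_integral//.
    rewrite -Rintegral_itv_obnd_cbnd; last first.
      apply: integrableS (C0_locint density_C0 x) => //.
      by apply: subset_itvr; rewrite bnd_simp.
    rewrite (@eq_Rintegral _ _ _ _ _ (fun=> 0)) ?Rintegral_cst ?mul0r//.
    by move=> z; rewrite inE/= in_itv/= => /andP[z0 _]; exact: f_eq0.
  have h0 : cdf Z r @[r --> +oo%R] --> (0 : \bar R)%E.
    apply: cvg_near_cst; near=> x.
    by rewrite -[LHS]fineK ?cdf_fin_num// -/(F x) F_eq0.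
  have e01 : (0 : \bar R)%E = 1%E.
    rewrite -[LHS](cvg_lim (@ereal_hausdorff R) h0).
    exact: (cvg_lim (@ereal_hausdorff R) (cvg_cdfy1 Z)).
  by case: e01 => /eqP; rewrite eq_sym oner_eq0.
have cfx : {for x, continuous f} by exact: C0_at density_C0 x0.
have [e /= e0 He] : \forall y \near x, f y != 0.
  exact: (cvgr_neq0 _ cfx).
(* The maximum with x / 2 keeps the left endpoint positive. *)
exists (Num.max (x / 2) (x - e / 2)), (x + e / 2); split.
- by rewrite lt_max divr_gt0.
- by rewrite gt_max; apply/andP; split; lra.
- move=> y; rewrite gt_max => /andP[/andP[y1 y2] y3]; apply: He => /=.
  by rewrite ltr_norml; apply/andP; split; lra.
Unshelve. all: by end_near. Qed.

End density.

(** * Regularity of the renewal solution *)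

Section renewal_solution_continuity.
Context {R : realType}.
Local Notation mu := (@lebesgue_measure R).
Variables (phi : R) (f v m : R -> R).
Hypotheses (cf : C0 f) (cv : C0 v) (bm : locally_bounded m).
Hypothesis hm : renewal_solution phi f v m.

(* [m (u - y)] is recovered from the measurable product [m (u - y) * f y] on an
   interval where [f] does not vanish; translates of that interval cover
   the half-line. *)
Lemma renewal_solution_measurable (a b : R) : 0 < a -> a < b ->
  (forall x, a < x < b -> f x != 0) ->
  forall c : R, measurable_fun `[0, c] m.
Proof.
move=> a0 ab fn0 c.
have mif : measurable_fun `]a, b[ (fun y => (f y)^-1).
  apply: open_continuous_measurable_fun => //.
  move=> x; rewrite inE/= in_itv/= => xab.
  apply: cvgV; first exact: fn0.
  by apply: (C0_at cf); move: xab => /andP[ax _]; exact: lt_trans ax.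
have step u : b <= u -> measurable_fun `]u - b, u - a[ m.
  move=> bu.
  have [imf _] := hm (ltW (lt_le_trans (lt_trans a0 ab) bu)).
  have m1 : measurable_fun `]a, b[ (fun y => m (u - y) * f y).
    apply: (@measurable_funS _ _ _ _ `[0, u]) => //.
      by move=> x /=; rewrite !in_itv/=; lra.
    by apply/measurable_EFinP; exact: (measurable_int mu imf).
  have m2 : measurable_fun `]a, b[ (fun y => m (u - y)).
    apply: eq_measurable_fun; last exact: (measurable_funM m1 mif).
    by move=> x; rewrite inE/= in_itv/= => xab; rewrite mulfK// fn0.
  have : measurable_fun `]u - b, u - a[ ((fun y => m (u - y)) \o (fun z => u - z)).
    apply: (measurable_comp (F := `]a, b[)) => //.
      by move=> _ [x /= + <-]; rewrite !in_itv/=; lra.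
    by apply: measurable_funTS; exact: measurable_refl.
  by apply: eq_measurable_fun => x _ /=; rewrite opprB addrC subrK.
(* Open intervals of length b - a moved by half that length: they overlap, so together they cover
   every x > 0. *)
pose E (n : nat) : set R := `](b + n%:R * ((b - a) / 2) - b), (b + n%:R * ((b - a) / 2) - a)[.
have dab : 0 < (b - a) / 2 by rewrite divr_gt0// subr_gt0.
have mE : measurable_fun (\bigcup_n E n) m.
  apply/measurable_fun_bigcup => n; first exact: measurable_itv.
  by apply: step; rewrite lerDl mulr_ge0// ltW.
apply/measurable_fun_itv_obnd_cbndP.
apply: measurable_funS mE; first by apply: bigcup_measurable => n _; exact: measurable_itv.
move=> x /=; rewrite in_itv/= => /andP[x0 _].
have xd0 : 0 <= x / ((b - a) / 2) by rewrite divr_ge0// ltW.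
pose k := Num.truncn (x / ((b - a) / 2)).
have /andP[k1 k2] : (k%:R <= x / ((b - a) / 2) < k.+1%:R) by exact: truncn_itv.
move: k1 k2; rewrite ler_pdivlMr// ltr_pdivrMr// => k1 k2.
(* If x is itself a multiple of the step it is the excluded left endpoint of [E k], and the
   preceding interval contains it; k > 0 because x > 0. *)
move: k1; rewrite le_eqVlt => /predU1P[k1|k1].
  exists k.-1 => //; rewrite /E /= in_itv/=.
  have [k0|k0] := posnP k; first by move: x0; rewrite -k1 k0 mul0r ltxx.
  by rewrite -(prednK k0) -natr1 in k1; apply/andP; split; lra.
exists k => //; rewrite /E /= in_itv/=.
by rewrite -natr1 in k2; apply/andP; split; lra.
Qed.

(** Measurable and locally bounded, [m] is a locally integrable kernel; convolving it with the
    continuous [f] makes the right-hand side of the equation continuous. *)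
Lemma renewal_solution_C0 (a b : R) : 0 < a -> a < b ->
  (forall x, a < x < b -> f x != 0) -> C0 m.
Proof.
move=> a0 ab fn0.
have im : locint m.
  by apply: bounded_locint => //; exact: renewal_solution_measurable ab fn0.
apply: (@C0_eq _ (fun u => phi * conv f m u + v u)).
  move=> u u0; have [imf ->] := hm u0; rewrite -convC//.
by apply: C0D => //; apply: C0Z; exact: conv_continuous.
Qed.

Lemma renewal_solutionE u : 0 <= u -> m u = phi * conv m f u + v u.
Proof. by move=> u0; have [_ {1}->] := hm u0. Qed.

End renewal_solution_continuity.

(** * Weighted suprema, absolute moments and iterated derivatives *)

Section weighted_norms.
Context {R : realType}.
Local Notation mu := (@lebesgue_measure R).
Implicit Types (p g h w : R -> R) (u x y K : R).

Lemma wnormE j g : (wnorm j g < +oo)%E ->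
  exists2 K, wnorm j g = K%:E & forall u, 0 < u -> u ^+ j * `|g u| <= K.
Proof.
move=> gj.
have ub u : 0 < u -> ((u ^+ j * `|g u|)%:E <= wnorm j g)%E.
  move=> u0; apply: ereal_sup_ubound; exists u; first by rewrite /= in_itv/= u0.
  by rewrite normrM ger0_norm// exprn_ge0// ltW.
have wfin : wnorm j g \is a fin_num.
  rewrite ge0_fin_numE//; apply: le_trans (ub 1 ltr01).
  by rewrite lee_fin mulr_ge0.
exists (fine (wnorm j g)); first by rewrite fineK.
by move=> u u0; rewrite -lee_fin fineK// ub.
Qed.

Lemma wnorm_le j g K : (forall u, 0 < u -> u ^+ j * `|g u| <= K) ->
  (wnorm j g <= K%:E)%E.
Proof.
move=> gK; apply: ge_ereal_sup => _ [u /= + <-]; rewrite in_itv/= andbT => u0.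
by rewrite lee_fin normrM ger0_norm ?gK// exprn_ge0// ltW.
Qed.

(** Continuity takes care of [0, 1]; beyond 1 the weight is at least 1. *)
Lemma C0_bounded_weighted w K : C0 w -> (forall u, 0 < u -> u ^+ 2 * `|w u| <= K) ->
  exists2 W, 0 <= W & forall u, 0 <= u -> `|w u| <= W.
Proof.
move=> cw wK; have [M M0 wM] := C0_bounded 1 cw.
exists (M + K).
  by rewrite addr_ge0// (le_trans _ (wK 1 ltr01))// mulr_ge0.
have K0 : 0 <= K by rewrite (le_trans _ (wK 1 ltr01))// mulr_ge0.
move=> u u0; have [u1|u1] := leP u 1.
  by rewrite (le_trans (wM u _)) ?u0// lerDl.
apply: (@le_trans _ _ K); last by rewrite lerDr.
apply: le_trans (wK u (lt_trans ltr01 u1)).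
by rewrite ler_peMl// exprn_ege1// ltW.
Qed.

Lemma Iabs_bounded i p : (forall u, 0 < u -> {for u, continuous p}) ->
  (Iabs i p < +oo)%E ->
  (forall c : R, mu.-integrable `[0, c] (fun y => (y ^+ i * `|p y|)%:E)) /\
  exists C : R, forall u, 0 <= u -> \int[mu]_(y in `[0, u]) (y ^+ i * `|p y|) <= C.
Proof.
move=> cp pi.
pose q y := y ^+ i * `|p y|.
have mq : measurable_fun (`]0, +oo[ : set R) q.
  apply: open_continuous_measurable_fun => // x.
  rewrite inE/= in_itv/= andbT => x0; apply: cvgM.
    exact: exprn_continuous.
  by apply: (@continuous_comp _ _ _ p Num.norm); [exact: cp|exact: norm_continuous].
have iq0 : mu.-integrable (`]0, +oo[ : set R) (EFin \o q).
  apply/integrableP; split; first exact/measurable_EFinP.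
  apply: le_lt_trans pi; rewrite /Iabs le_eqVlt; apply/orP; left; apply/eqP.
  apply: eq_integral => x; rewrite inE/= in_itv/= andbT => x0.
  by rewrite ger0_norm// mulr_ge0// exprn_ge0// ltW.
have iq1 : mu.-integrable (`[0, +oo[ : set R) (EFin \o q).
  apply/integrableP; split.
    by apply/measurable_EFinP/measurable_fun_itv_obnd_cbndP.
  rewrite -integral_itv_obnd_cbnd; first by case/integrableP: iq0.
  apply: measurableT_comp => //; exact/measurable_EFinP.
have iq c : mu.-integrable `[0, c] (EFin \o q).
  apply: integrableS iq1 => //; apply: subset_itvl; by rewrite bnd_simp.
split=> //; exists (\int[mu]_(y in `[0, +oo[) q y) => u u0.
rewrite -subr_ge0 (@Rintegral_itvB _ q (BLeft 0) +oo%O)//.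
apply: Rintegral_ge0 => x /=; rewrite in_itv/= andbT => ux.
by rewrite mulr_ge0// exprn_ge0// (le_trans u0)// ltW.
Qed.

Lemma Iabs_locint p : (forall u, 0 < u -> {for u, continuous p}) ->
  (Iabs 0 p < +oo)%E -> locint p.
Proof.
move=> cp pi c; have [/(_ c) ip _] := Iabs_bounded cp pi.
apply/integrableP; split.
  apply/measurable_EFinP/measurable_fun_itv_obnd_cbndP.
  apply: (@measurable_funS _ _ _ _ (`]0, +oo[ : set R)) => //.
    by apply: subset_itvl; rewrite bnd_simp.
  apply: open_continuous_measurable_fun => // x.
  by rewrite inE/= in_itv/= andbT; exact: cp.
move/integrableP : ip => [_]; apply: le_lt_trans.
rewrite le_eqVlt; apply/orP; left; apply/eqP.
by apply: eq_integral => x _ /=; rewrite expr0 mul1r normr_id.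
Qed.

Lemma dpos_derive1n n g g1 g2 : (forall u, 0 < u -> g^`(n) u = g1 u) ->
  dpos g1 g2 -> forall u, 0 < u -> g^`(n.+1) u = g2 u.
Proof.
move=> gE dg u u0; rewrite derive1nS; apply: (dpos_derive1 _ u0).
by apply: dpos_eq dg => x x0; rewrite gE.
Qed.

Lemma dern_dern j k g u : 0 < u -> dern k (dern j g) u = dern (k + j) g u.
Proof.
move=> u0; rewrite !dern_gt0//; elim: k u u0 => [|k IH] u u0.
  by rewrite add0n /= dern_gt0.
rewrite addSn !derive1nS !derive1E; apply: near_eq_derive.
by near=> x; apply: IH; near: x; exact: near_pos.
Unshelve. all: by end_near. Qed.

Lemma dern_continuous j n g u : Cn n (dern j g) -> 0 < u ->
  {for u, continuous (dern (n + j) g)}.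
Proof.
move=> cn u0; have := Cn_continuous cn u0.
rewrite /prop_for /continuous_at (dern_dern j n g u0); apply: cvg_trans.
apply: near_eq_cvg; near=> x; rewrite dern_dern//.
by near: x; exact: near_pos.
Unshelve. all: by end_near. Qed.

Lemma dern_dpos j n k g : Cn n (dern j g) -> (k < n)%N ->
  dpos (dern (k + j) g) (dern (k.+1 + j) g).
Proof.
move=> cn kn u u0; rewrite -(dern_dern j k.+1 g u0).
apply: dpos_eq (Cn_dpos cn kn) _ u0 => x x0; exact: dern_dern.
Qed.

End weighted_norms.

(** * Derivatives of the renewal solution and their bounds *)

Section regularity.
Context {R : realType}.
Local Notation mu := (@lebesgue_measure R).
Variables (phi : R) (f v m : R -> R).
Hypotheses (phi0 : 0 < phi) (phi1 : phi < 1).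
Hypotheses (cf : C0 f) (dcf : dpos f (dern 1 f)) (cm : C0 m).
Hypothesis f_ge0 : forall u, 0 <= u -> 0 <= f u.
Hypothesis f_le1 : forall u, 0 <= u -> \int[mu]_(z in `[0, u]) f z <= 1.
Hypothesis f_moment : exists C : R, forall u, 0 <= u ->
  \int[mu]_(y in `[0, u]) (y ^+ 2 * f y) <= C.
Hypothesis mE : forall u, 0 <= u -> m u = phi * conv m f u + v u.
Hypotheses (cnv : Cn0 2 v) (cnf1 : Cn 2 (dern 1 f)) (cnv2 : Cn 2 (dern 2 v)).
Hypotheses (I0 : (Iabs 0 (dern 2 f) < +oo)%E) (I2 : (Iabs 2 (dern 2 f) < +oo)%E).

Let cf1 : C0 (dern 1 f) := Cn_C0 cnf1.
Let df1 : dpos (dern 1 f) (dern 2 f) := dern_dpos cnf1 (ltn0Sn 1).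
Let df2 : dpos (dern 2 f) (dern 3 f) := dern_dpos cnf1 (ltnSn 1).
Let cf2 u : 0 < u -> {for u, continuous (dern 2 f)} := dpos_continuous df2.
Let cf3 u : 0 < u -> {for u, continuous (dern 3 f)} := dern_continuous cnf1.

Let dv : dpos v (dern 1 v).
Proof.
apply: dpos_eq (Cn_dpos (Cn0_Cn cnv) (ltn0Sn 1)) => u u0.
by rewrite dern_gt0.
Qed.
Let dv1 : dpos (dern 1 v) (dern 2 v) := Cn_dpos (Cn0_Cn cnv) (ltnSn 1).
Let cv1 : C0 (dern 1 v) := Cn0_C0 cnv (isT : (0 < 1 <= 2)%N).
Let cv2 : C0 (dern 2 v) := Cn0_C0 cnv (isT : (0 < 2 <= 2)%N).
Let dv2 : dpos (dern 2 v) (dern 3 v) := dern_dpos cnv2 (ltn0Sn 1).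
Let dv3 : dpos (dern 3 v) (dern 4 v) := dern_dpos cnv2 (ltnSn 1).
Let cv4 u : 0 < u -> {for u, continuous (dern 4 v)} := dern_continuous cnv2.

Let lf2 : locint (dern 2 f) := Iabs_locint cf2 I0.

Let w1_ := w1 phi f v m.
Let w1' u := phi * m 0 * dern 1 f u + dern 2 v u.
Let w1'' u := phi * m 0 * dern 2 f u + dern 3 v u.
Let w1''' u := phi * m 0 * dern 3 f u + dern 4 v u.

Let dpos_lin c (g g' h h' : R -> R) : dpos g g' -> dpos h h' ->
  dpos (fun u => c * g u + h u) (fun u => c * g' u + h' u).
Proof.
by move=> dg dh u u0; apply: is_deriveD1 (dh u u0); apply: is_deriveZ1 (dg u u0).
Qed.

Let cw1 : C0 w1_.
Proof. by apply: C0D => //; exact: C0Z. Qed.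
Let cw1' : C0 w1'. Proof. by apply: C0D => //; exact: C0Z. Qed.
Let dw1 : dpos w1_ w1' := dpos_lin (phi * m 0) dcf dv1.
Let dw1' : dpos w1' w1'' := dpos_lin (phi * m 0) df1 dv2.
Let dw1'' : dpos w1'' w1''' := dpos_lin (phi * m 0) df2 dv3.

Let m1 u := phi * (f 0 * m u + conv m (dern 1 f) u) + dern 1 v u.
Let dm : dpos m m1 := renewal_dpos cf cf1 dcf cm mE dv.
Let cm1 : C0 m1. Proof. by have [] := renewal_derive cf cf1 dcf cm mE dv cv1. Qed.
Let m1E u : 0 <= u -> m1 u = phi * conv m1 f u + w1_ u.
Proof. by have [_] := renewal_derive cf cf1 dcf cm mE dv cv1; apply. Qed.

Let m2 u := phi * (f 0 * m1 u + conv m1 (dern 1 f) u) + w1' u.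
Let dm1 : dpos m1 m2 := renewal_dpos cf cf1 dcf cm1 m1E dw1.
Let cm2 : C0 m2. Proof. by have [] := renewal_derive cf cf1 dcf cm1 m1E dw1 cw1'. Qed.

Let W2 u := phi * m1 0 * f u + w1' u.
Let W2' u := phi * m1 0 * dern 1 f u + w1'' u.
Let W2'' u := phi * m1 0 * dern 2 f u + w1''' u.
Let dW2 : dpos W2 W2' := dpos_lin (phi * m1 0) dcf dw1'.
Let dW2' : dpos W2' W2'' := dpos_lin (phi * m1 0) df1 dw1''.
Let cW2 : C0 W2. Proof. by apply: C0D => //; exact: C0Z. Qed.
Let m2E u : 0 <= u -> m2 u = phi * conv m2 f u + W2 u.
Proof. by have [_] := renewal_derive cf cf1 dcf cm1 m1E dw1 cw1'; apply. Qed.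

Let W2E u : 0 <= u -> w2 phi f v m u = W2 u.
Proof.
move=> u0; rewrite /w2 (dpos_dern1_C0 dm cm1 (lexx 0)).
by rewrite -/w1_ (dpos_dern1_C0 dw1 cw1' u0).
Qed.

Let m3 u := phi * (f 0 * m2 u + conv m2 (dern 1 f) u) + W2' u.
Let m4 u := phi * (f 0 * m3 u + (dern 1 f 0 * m2 u + conv m2 (dern 2 f) u)) + W2'' u.
Let dm2 : dpos m2 m3 := renewal_dpos cf cf1 dcf cm2 m2E dW2.
Let dm3 : dpos m3 m4 := renewal_dpos2 phi f cf1 cm2 dm2 df1 lf2 cf2 dW2'.

(** A second formula for m'''. The definition of [m3], built on the equation for m'', is the one
    that can be differentiated again; this one, with m' convolved against f'', is the one that can
    be bounded, because the moments assumed are those of f'' and the forcing term is w_1''. *)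
Let m3E u : 0 < u ->
  m3 u = phi * (f 0 * m2 u + (dern 1 f 0 * m1 u + conv m1 (dern 2 f) u)) + w1'' u.
Proof.
move=> u0; rewrite -(dpos_derive1 dm2 u0).
exact: (dpos_derive1 (renewal_dpos2 phi f cf1 cm1 dm1 df1 lf2 cf2 dw1')).
Qed.

Let cm4 u : 0 < u -> {for u, continuous m4}.
Proof.
move=> u0.
have c2 := C0_at cm2 u0; have c3 := dpos_continuous dm3 u0.
have cc := C0_at (conv_continuous cm2 lf2) u0.
have k (c : R) : c @[_ --> u] --> c by exact: cvg_cst.
apply: cvgD; last first.
  apply: cvgD; first by apply: cvgM; [exact: k|exact: cf2].
  apply: cvgD; last exact: cv4.
  by apply: cvgM; [exact: k|exact: cf3].
apply: cvgM; first exact: k.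
apply: cvgD; first by apply: cvgM; [exact: k|exact: c3].
apply: cvgD; last exact: cc.
by apply: cvgM; [exact: k|exact: c2].
Qed.

Hypotheses (w1b : (wnorm 2 w1_ < +oo)%E) (w2b : (wnorm 2 (w2 phi f v m) < +oo)%E).
Hypothesis w1b2 : (wnorm 2 (dern 2 w1_) < +oo)%E.
Hypothesis w2b2 : (wnorm 2 (dern 2 (w2 phi f v m)) < +oo)%E.

Let w1''E u : 0 < u -> dern 2 w1_ u = w1'' u.
Proof.
move=> u0; rewrite (dern_gt0 2 w1_ u0).
apply: (dpos_derive1n _ dw1' u0); apply: (dpos_derive1n _ dw1).
by move=> x x0; exact: erefl.
Qed.

Let W2''E u : 0 < u -> dern 2 (w2 phi f v m) u = W2'' u.
Proof.
move=> u0; rewrite (dern_gt0 2 _ u0).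
apply: (dpos_derive1n _ dW2' u0); apply: (dpos_derive1n _ dW2) => x x0.
exact: W2E (ltW x0).
Qed.

Let weighted_bounds h w : C0 h -> C0 w ->
  (forall u, 0 <= u -> h u = phi * conv h f u + w u) -> (wnorm 2 w < +oo)%E ->
  exists B S, (forall u, 0 <= u -> `|h u| <= B) /\
              (forall u, 0 <= u -> u ^+ 2 * `|h u| <= S).
Proof.
move=> ch cw hE /wnormE[K _ wK].
have [W W0 wW] := C0_bounded_weighted cw wK.
have wK0 u : 0 <= u -> u ^+ 2 * `|w u| <= K.
  rewrite le_eqVlt => /predU1P[<-|]; last exact: wK.
  by rewrite expr0n mul0r (le_trans _ (wK 1 ltr01))// mulr_ge0.
have hB := renewal_bounded phi0 phi1 cf f_ge0 f_le1 ch hE wW.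
have [C fC] := f_moment.
have [S hS] := renewal_weighted_bounded phi0 phi1 cf f_ge0 f_le1 ch hE hB wK0 fC.
by exists (W / (1 - phi)), S.
Qed.

Lemma renewal_solution_D1 : exists B K : R,
  [/\ Cn 4 m, forall u, 0 < u -> `|m^`(2) u| <= B &
      forall u, 0 < u -> u ^+ 2 * `|m^`(4) u| <= K].
Proof.
have [B1 [S1 [m1B m1S]]] := weighted_bounds cm1 cw1 m1E w1b.
have w2b' : (wnorm 2 W2 < +oo)%E.
  have [K _ wK] := wnormE w2b; apply: (@le_lt_trans _ _ K%:E); last exact: ltry.
  by apply: wnorm_le => u u0; rewrite -W2E ?wK// ltW.
have [B2 [S2 [m2B m2S]]] := weighted_bounds cm2 cW2 m2E w2b'.
have [K1 _ w1K] := wnormE w1b2.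
have [K2 _ w2K] := wnormE w2b2.
have [i0 [J0 fJ0]] := Iabs_bounded cf2 I0.
have [i2 [J2 fJ2]] := Iabs_bounded cf2 I2.
have fJ0' u : 0 <= u -> \int[mu]_(y in `[0, u]) `|dern 2 f y| <= J0.
  move=> u0; apply: le_trans (fJ0 u u0); rewrite le_eqVlt; apply/orP; left.
  by apply/eqP/eq_Rintegral => z _; rewrite mul1r.
have c1 := conv_weighted_bounded cm1 lf2 i2 m1B m1S fJ0' fJ2.
have c2 := conv_weighted_bounded cm2 lf2 i2 m2B m2S fJ0' fJ2.
(* The common shape of m''' in the form [m3E] and of m'''' as [m4]. *)
have lin a b c (x y z w : R) u : 0 < u -> u ^+ 2 * `|x| <= a -> u ^+ 2 * `|y| <= b ->
    u ^+ 2 * `|z| <= c -> u ^+ 2 * `|phi * (f 0 * x + (dern 1 f 0 * y + z)) + w| <=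
    phi * (`|f 0| * a + (`|dern 1 f 0| * b + c)) + u ^+ 2 * `|w|.
  move=> u0 xa yb zc.
  have u2 : 0 <= u ^+ 2 by exact: sqr_ge0.
  apply: le_trans (ler_wpM2l u2 (ler_normD _ _)) _; rewrite mulrDr lerD2r.
  rewrite normrM (gtr0_norm phi0) mulrCA ler_wpM2l ?(ltW phi0)//.
  apply: le_trans (ler_wpM2l u2 (ler_normD _ _)) _; rewrite mulrDr lerD//.
    by rewrite normrM mulrCA ler_wpM2l.
  apply: le_trans (ler_wpM2l u2 (ler_normD _ _)) _; rewrite mulrDr lerD//.
  by rewrite normrM mulrCA ler_wpM2l.
pose S3 := phi * (`|f 0| * S2 + (`|dern 1 f 0| * S1 + 2 * (S1 * J0 + B1 * J2))) + K1.
have m3S u : 0 < u -> u ^+ 2 * `|m3 u| <= S3.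
  move=> u0; rewrite m3E//.
  apply: le_trans (lin _ _ _ _ _ _ _ u u0 (m2S u (ltW u0)) (m1S u (ltW u0)) (c1 u (ltW u0))) _.
  by rewrite lerD2l -w1''E// w1K.
pose S4 := phi * (`|f 0| * S3 + (`|dern 1 f 0| * S2 + 2 * (S2 * J0 + B2 * J2))) + K2.
have m4S u : 0 < u -> u ^+ 2 * `|m4 u| <= S4.
  move=> u0.
  apply: le_trans (lin _ _ _ _ _ _ _ u u0 (m3S u u0) (m2S u (ltW u0)) (c2 u (ltW u0))) _.
  by rewrite lerD2l -W2''E// w2K.
have m0E x : 0 < x -> m^`(0) x = m x by [].
have m1E' := dpos_derive1n m0E dm.
have m2E' := dpos_derive1n m1E' dm1.
have m3E' := dpos_derive1n m2E' dm2.
have m4E' := dpos_derive1n m3E' dm3.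
have dmn n (g g' : R -> R) u : (forall x, 0 < x -> m^`(n) x = g x) -> dpos g g' ->
    0 < u -> derivable m^`(n) u 1.
  move=> gE dg u0; have [+ _] : is_derive u 1 m^`(n) (g' u); last by [].
  by apply: dpos_eq dg _ u0 => x x0; rewrite gE.
exists B2, S4; split; last 2 first.
- by move=> u u0; rewrite m2E'// m2B// ltW.
- by move=> u u0; rewrite m4E'// m4S.
split => //.
- case=> [|[|[|[|k /notF//]]]] _ u u0.
  + exact: dmn m0E dm u0.
  + exact: dmn m1E' dm1 u0.
  + exact: dmn m2E' dm2 u0.
  + exact: dmn m3E' dm3 u0.
- move=> u; rewrite inE/= in_itv/= andbT => u0.
  suff : m^`(4) x @[x --> u] --> m^`(4) u by [].
  rewrite (m4E' _ u0); apply: cvg_trans (cm4 u0).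
  apply: near_eq_cvg; near=> x; rewrite m4E'//.
  by near: x; exact: near_pos.
Unshelve. all: by end_near. Qed.

End regularity.

(** * Laplace transforms and gamma averages *)

Section laplace_transform.
Context {R : realType}.
Local Notation mu := (@lebesgue_measure R).
Local Notation half_line := (`[0, +oo[ : set R).
Implicit Types (g h : R -> R) (s t u : R).

(** Growth below every exponential, with bounds valid on the whole half-line: the class is stable
    under products and contains polynomials, so all transforms of u^n g exist for every t > 0. *)
Definition subexp g := forall s : R, 0 < s ->
  exists C : R, forall u : R, 0 <= u -> `|g u| <= C * expR (s * u).

Lemma le_subexp g h : (forall u, 0 <= u -> `|g u| <= `|h u|) ->
  subexp h -> subexp g.
Proof.
move=> gh hs s s0; have [C hC] := hs s s0; exists C => u u0.
exact: le_trans (gh u u0) (hC u u0).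
Qed.

Lemma subexpM g h : subexp g -> subexp h -> subexp (fun u => g u * h u).
Proof.
move=> gs hs s s0.
have s20 : 0 < s / 2 by rewrite divr_gt0.
have [C gC] := gs _ s20; have [D hD] := hs _ s20.
exists (C * D) => u u0; rewrite normrM.
have -> : expR (s * u) = expR (s / 2 * u) * expR (s / 2 * u).
  by rewrite -expRD; congr expR; lra.
by rewrite mulrACA ler_pM ?gC ?hD.
Qed.

Lemma subexpD g h : subexp g -> subexp h -> subexp (fun u => g u + h u).
Proof.
move=> gs hs s s0; have [C gC] := gs _ s0; have [D hD] := hs _ s0.
exists (C + D) => u u0; rewrite mulrDl.
by apply: le_trans (ler_normD _ _) _; rewrite lerD ?gC ?hD.
Qed.

Lemma subexp_cst (c : R) : subexp (fun=> c).
Proof.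
move=> s s0; exists `|c| => u u0.
by rewrite ler_peMr// -expR0 ler_expR mulr_ge0// ltW.
Qed.

Lemma subexp_id : subexp id.
Proof.
move=> s s0; exists s^-1 => u u0.
rewrite ger0_norm// -ler_pdivrMl ?invr_gt0// invrK.
by apply: le_trans (expR_ge1Dx _); rewrite lerDr.
Qed.

Lemma subexpX g n : subexp g -> subexp (fun u => g u ^+ n).
Proof.
move=> gs; elim: n => [|n IH]; first exact: subexp_cst.
by apply: le_subexp (subexpM gs IH) => u u0; rewrite exprS.
Qed.

Lemma subexpXM g n : subexp g -> subexp (fun u => u ^+ n * g u).
Proof. by move=> gs; apply: subexpM => //; exact/subexpX/subexp_id. Qed.

Lemma C0XM g n : C0 g -> C0 (fun u => u ^+ n * g u).
Proof. by move=> cg; apply: C0M => //; exact/C0X/C0_id. Qed.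

Lemma is_derive_expRN t u : is_derive u 1 (fun x => expR (- (t * x))) (- t * expR (- (t * u))).
Proof.
have h : is_derive u 1 (fun x => - t * x) (- t).
  by have := is_deriveZ (- t) (is_derive_id u (1 : R)); rewrite scaler1.
have -> : (fun x => expR (- (t * x))) = @expR R \o (fun x => - t * x).
  by apply/funext => x /=; rewrite mulNr.
by rewrite mulrC -[t * u]opprK -mulNr opprK; exact: is_derive1_comp.
Qed.

Lemma continuous_expRN t : continuous (fun x : R => expR (- (t * x))).
Proof.
move=> u; apply/differentiable_continuous/derivable1_diffP.
by have ? := is_derive_expRN t u; exact: ex_derive.
Qed.

Lemma integral_expRN t : 0 < t ->
  (\int[mu]_(u in half_line) (expR (- (t * u)))%:E = (t^-1)%:E)%E.
Proof.
move=> t0.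
have dF u : is_derive u 1 (fun x => - t^-1 * expR (- (t * x))) (expR (- (t * u))).
  have := is_deriveZ1 (- t^-1) (is_derive_expRN t u).
  by rewrite mulrA mulrNN mulVf ?gt_eqF// mul1r.
rewrite (@ge0_continuous_FTC2y R _ (fun x => - t^-1 * expR (- (t * x))) 0 0).
- by rewrite mulr0 oppr0 expR0 mulr1 -EFinD sub0r opprK.
- by move=> x _; exact: expR_ge0.
- by apply: continuous_subspaceT; exact: continuous_expRN.
- rewrite -[X in _ --> X](mulr0 (- t^-1)); apply: cvgM; first exact: cvg_cst.
  have -> : (fun x => expR (- (t * x))) = (fun x => expR (- x)) \o (fun x => t * x) by [].
  apply: (cvg_comp _ _ _ (@cvgr_expR R)).
  by apply: (gt0_cvgMry t0); exact: cvg_id.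
- by move=> x _; exact: ex_derive.
- apply: cvg_at_right_filter; apply: cvgM; first exact: cvg_cst.
  exact: continuous_expRN.
- by move=> x _; rewrite derive1E; exact: derive_val.
Qed.

Lemma integrable_expRN t : 0 < t -> mu.-integrable half_line (fun u => (expR (- (t * u)))%:E).
Proof.
move=> t0; apply/integrableP; split.
  apply/measurable_EFinP; apply: measurable_funTS.
  apply: continuous_measurable_fun; exact: continuous_expRN.
under eq_integral do rewrite gee0_abs ?lee_fin ?expR_ge0//.
by rewrite integral_expRN// ltry.
Qed.

Lemma C0_measurable g : C0 g -> measurable_fun half_line g.
Proof. by move=> cg; apply: subspace_continuous_measurable_fun => //. Qed.

Lemma laplace_integrable g t : C0 g -> subexp g -> 0 < t ->
  mu.-integrable half_line (fun u => (expR (- (t * u)) * g u)%:E).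
Proof.
move=> cg gs t0.
have t20 : 0 < t / 2 by rewrite divr_gt0.
have [C gC] := gs _ t20.
apply: (@le_integrable _ _ _ mu _ _ _ (fun u => (C%:E * (expR (- (t / 2 * u)))%:E)%E)) => //.
- apply/measurable_EFinP; apply: measurable_funM; last exact: C0_measurable.
  apply: measurable_funTS; apply: continuous_measurable_fun; exact: continuous_expRN.
- move=> u; rewrite /= in_itv/= andbT => u0.
  rewrite lee_fin normrM ger0_norm ?expR_ge0//.
  apply: (@le_trans _ _ (C * expR (- (t / 2 * u)))); last exact: ler_norm.
  have -> : expR (- (t / 2 * u)) = expR (t / 2 * u) * expR (- (t * u)).
    by rewrite -expRD; congr expR; lra.
  by rewrite mulrA [leRHS]mulrC ler_wpM2l ?expR_ge0// gC.
- by apply: integrableZl => //; exact: integrable_expRN.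
Qed.

Lemma laplaceZ c g t : C0 g -> subexp g -> 0 < t ->
  laplace (fun u => c * g u) t = c * laplace g t.
Proof.
move=> cg gs t0; rewrite /laplace -RintegralZl//; last exact: laplace_integrable.
by apply: eq_Rintegral => u _; rewrite mulrCA.
Qed.

Lemma laplaceD g h t : C0 g -> subexp g -> C0 h -> subexp h -> 0 < t ->
  laplace (fun u => g u + h u) t = laplace g t + laplace h t.
Proof.
move=> cg gs ch hs t0; rewrite /laplace -RintegralD//; last 2 first.
- exact: laplace_integrable.
- exact: laplace_integrable.
by apply: eq_Rintegral => u _; rewrite mulrDr.
Qed.

Lemma eq_laplace g h t : (forall u, 0 <= u -> g u = h u) -> laplace g t = laplace h t.
Proof.
by move=> gh; apply: eq_Rintegral => u; rewrite inE/= in_itv/= andbT => /gh ->.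
Qed.

(** The pointwise bound is asked for u > 0 only, since the Taylor remainder is controlled only
    there; the point 0 is null. *)
Lemma le_laplace g h t : C0 g -> subexp g -> C0 h -> subexp h -> 0 < t ->
  (forall u, 0 < u -> `|g u| <= h u) -> `|laplace g t| <= laplace h t.
Proof.
move=> cg gs ch hs t0 gh.
have ig := laplace_integrable cg gs t0; have ih := laplace_integrable ch hs t0.
have sub : `]0, +oo[ `<=` half_line by apply: subset_itvr; rewrite bnd_simp.
rewrite /laplace -Rintegral_itv_obnd_cbnd; last exact: integrableS ig.
rewrite -[leRHS]Rintegral_itv_obnd_cbnd; last exact: integrableS ih.
apply: le_trans (le_normr_Rintegral _ _) _ => //; first exact: integrableS ig.
apply: le_Rintegral => //.
- by apply: (@integrable_norm _ _ _ mu _ (fun u => expR (- (t * u)) * g u)); exact: integrableS ig.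
- exact: integrableS ih.
- move=> u; rewrite /= in_itv/= andbT => u0.
  by rewrite normrM ger0_norm ?expR_ge0// ler_wpM2l ?expR_ge0// gh.
Qed.

(** Differentiation under the integral for parameters in ]t / 2, 2 t[, dominated by exp (- t u / 2)
    |u g u|. *)
Lemma laplace_dpos g : C0 g -> subexp g ->
  dpos (laplace g) (fun t => - laplace (fun u => u * g u) t).
Proof.
move=> cg gs t t0.
pose f (s u : R) := expR (- (s * u)) * g u.
have d1f s u : is_derive s 1 (f ^~ u) (- u * expR (- (s * u)) * g u).
  have -> : f ^~ u = (fun s => g u * expR (- (u * s))).
    by apply/funext => x; rewrite /f mulrC (mulrC x).
  have := is_deriveZ1 (g u) (is_derive_expRN u s).
  by rewrite (mulrC u s) (mulrC (g u)).
have cug : C0 (fun u => u * g u) by exact: (C0M C0_id).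
have sug : subexp (fun u => u * g u) by exact: (subexpM subexp_id).
have It : `]t / 2, (t * 2)[%classic t.
  by rewrite /= in_itv/= ltr_pdivrMr// ltr_pMr// ltr1n.
have intf x : `]t / 2, (t * 2)[%classic x -> mu.-integrable half_line (EFin \o f x).
  rewrite /= in_itv/= => /andP[tx _]; apply: laplace_integrable => //.
  by apply: lt_trans tx; rewrite divr_gt0.
have derf x y : `]t / 2, (t * 2)[%classic x -> half_line y -> derivable (f ^~ y) x 1.
  by move=> _ _; have ? := d1f x y; exact: ex_derive.
pose G (y : R) := `|expR (- (t / 2 * y)) * (y * g y)|.
have G0 y : 0 <= G y by exact: normr_ge0.
have iG : mu.-integrable half_line (EFin \o G).
  apply: (@integrable_norm _ _ _ mu _ (fun y => expR (- (t / 2 * y)) * (y * g y))).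
  by apply: laplace_integrable => //; rewrite divr_gt0.
have d1E x y : partial1of2 f x y = - y * expR (- (x * y)) * g y.
  by rewrite partial1of2E; have ? := d1f x y; exact: derive_val.
have Gub x y : `]t / 2, (t * 2)[%classic x -> half_line y -> `|partial1of2 f x y| <= G y.
  rewrite /= !in_itv/= andbT => /andP[tx _] y0.
  rewrite d1E /G -mulrA mulNr normrN mulrCA !normrM ler_wpM2r//.
  by rewrite !ger0_norm ?expR_ge0// ler_expR lerN2 ler_wpM2r// ltW.
have mH : measurable (half_line : set (measurableTypeR R)) by exact: measurable_itv.
have dL := derivable_under_integral mH It intf derf G0 iG Gub.
have dE := differentiation_under_integral mH It intf derf G0 iG Gub.
have -> : - laplace (fun u => u * g u) t = (laplace g)^`() t.
  rewrite dE -mulN1r -laplaceZ//; apply: eq_Rintegral => u _.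
  by rewrite d1E; ring.
by rewrite derive1E; apply/derivableP; exact: dL.
Qed.

Lemma laplace_derive1n g n : C0 g -> subexp g ->
  (forall t, 0 < t -> (laplace g)^`(n) t = (-1) ^+ n * laplace (fun u => u ^+ n * g u) t)
  /\ (forall t, 0 < t -> derivable (laplace g)^`(n) t 1).
Proof.
move=> cg gs.
suff H : forall t, 0 < t ->
    (laplace g)^`(n) t = (-1) ^+ n * laplace (fun u => u ^+ n * g u) t.
  split=> // t t0.
  have : dpos (laplace g)^`(n) (fun t => (-1) ^+ n * - laplace (fun u => u * (u ^+ n * g u)) t).
    apply: (@dpos_eq _ (fun t => (-1) ^+ n * laplace (fun u => u ^+ n * g u) t)).
      by move=> u u0; rewrite H.
    move=> s s0.
    exact: (is_deriveZ1 _ (@laplace_dpos _ (@C0XM g n cg) (@subexpXM g n gs) s s0)).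
  by move=> /(_ t t0) ?; exact: ex_derive.
elim: n => [|n IH] t t0.
  by rewrite expr0 mul1r /=; apply: eq_laplace => u _; rewrite mul1r.
apply: (@dpos_derive1n R n (laplace g) (fun t => (-1) ^+ n * laplace (fun u => u ^+ n * g u) t)
  (fun t => (-1) ^+ n.+1 * laplace (fun u => u ^+ n.+1 * g u) t) IH _ t t0) => s s0.
have -> : (-1) ^+ n.+1 * laplace (fun u => u ^+ n.+1 * g u) s =
    (-1) ^+ n * - laplace (fun u => u * (u ^+ n * g u)) s.
  rewrite exprS mulN1r mulNr -mulrN; congr (_ * - _).
  by apply: eq_laplace => u _; rewrite exprS mulrA.
exact: (is_deriveZ1 _ (@laplace_dpos _ (@C0XM g n cg) (@subexpXM g n gs) s s0)).
Qed.

Lemma is_deriveXn s n : is_derive s 1 (fun t : R => t ^+ n) (n%:R * s ^+ n.-1).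
Proof.
have := @is_deriveX R R id n s 1 1 (is_derive_id s 1).
rewrite (_ : id ^+ n = fun t : R => t ^+ n) /GRing.scale /= ?mulr1//.
by rewrite fctE.
Qed.

(** Differentiating the formula for n in t, once through [laplace_dpos] and once explicitly, yields
    the formula for n + 1 without integration by parts. *)
Lemma laplace_expn n t : 0 < t -> laplace (fun u => u ^+ n) t = n`!%:R / t ^+ n.+1.
Proof.
elim: n t => [|n IH] t t0.
  rewrite /laplace fact0 expr1 div1r.
  under eq_Rintegral do rewrite expr0 mulr1.
  by rewrite /Rintegral integral_expRN.
have cX : C0 (fun u : R => u ^+ n) by exact/C0X/C0_id.
have sX : subexp (fun u : R => u ^+ n) by exact/subexpX/subexp_id.
have d1 := laplace_dpos cX sX.
have d2 : dpos (laplace (fun u => u ^+ n)) (fun t => - (n.+1`!%:R / t ^+ n.+2)).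
  apply: (@dpos_eq _ (fun t => n`!%:R * (t ^+ n.+1)^-1)); first by move=> s s0; rewrite IH.
  move=> s s0.
  have sn0 : s ^+ n.+1 != 0 by rewrite expf_neq0// gt_eqF.
  have s_neq0 : s != 0 by rewrite gt_eqF.
  have := is_deriveZ1 n`!%:R
    (@is_deriveV R (fun t => t ^+ n.+1) s _ 1 sn0 (is_deriveXn s n.+1)).
  rewrite (_ : _ * _ = - (n.+1`!%:R / s ^+ n.+2))//.
  rewrite factS natrM !exprS /GRing.scale /=; field.
  by rewrite s_neq0 expf_neq0.
have e1 := dpos_derive1 d1 t0; have e2 := dpos_derive1 d2 t0.
have : laplace (fun u => u * u ^+ n) t = n.+1`!%:R / t ^+ n.+2.
  by apply: oppr_inj; rewrite -e1 -e2.
by move=> <-; apply: eq_laplace => u _; rewrite exprS.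
Qed.

End laplace_transform.

(** * Gamma averages and the Taylor remainder *)

Section gamma_averages.
Context {R : realType}.
Local Notation mu := (@lebesgue_measure R).
Implicit Types (g h : R -> R) (a b s t u x y z K : R) (n : nat).

(* [gam n t g] is [E g (S (n + 1) / t)], with [S r] gamma of shape [r] *)
Definition gam n t g := t ^+ n.+1 / n`!%:R * laplace (fun u => u ^+ n * g u) t.

Lemma LstarE n t g u : C0 g -> subexp g -> 0 < t -> Num.truncn (t * u) = n ->
  Lstar t g u = gam n t g.
Proof.
move=> cg gs t0 tun; rewrite /Lstar tun /gam.
have [-> // _] := laplace_derive1n n cg gs.
have ee : (-1) ^+ n * (-1) ^+ n = 1 :> R by rewrite -expr2 sqrr_sign.
move: ee; set e := (-1) ^+ n; set L := laplace _ _ => ee.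
by rewrite mulrCA -!mulrA [e * _]mulrCA [e * _]mulrCA (mulrA e) ee mul1r.
Qed.

Lemma gamZ n t c g : C0 g -> subexp g -> 0 < t ->
  gam n t (fun u => c * g u) = c * gam n t g.
Proof.
move=> cg gs t0; rewrite /gam [RHS]mulrCA.
rewrite -(laplaceZ c (@C0XM _ g n cg) (@subexpXM _ g n gs) t0).
by congr (_ * _); apply: eq_laplace => u _; rewrite mulrCA.
Qed.

Lemma gamD n t g h : C0 g -> subexp g -> C0 h -> subexp h -> 0 < t ->
  gam n t (fun u => g u + h u) = gam n t g + gam n t h.
Proof.
move=> cg gs ch hs t0; rewrite /gam -mulrDr.
rewrite -(laplaceD (@C0XM _ g n cg) (@subexpXM _ g n gs)
                   (@C0XM _ h n ch) (@subexpXM _ h n hs) t0).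
by congr (_ * _); apply: eq_laplace => u _; rewrite mulrDr.
Qed.

Lemma eq_gam n t g h : (forall u, 0 <= u -> g u = h u) -> gam n t g = gam n t h.
Proof. by move=> gh; congr (_ * _); apply: eq_laplace => u u0; rewrite gh. Qed.

Lemma le_gam n t g h : C0 g -> subexp g -> C0 h -> subexp h -> 0 < t ->
  (forall u, 0 < u -> `|g u| <= h u) -> `|gam n t g| <= gam n t h.
Proof.
move=> cg gs ch hs t0 gh.
have c0 : 0 <= t ^+ n.+1 / n`!%:R by rewrite divr_ge0// exprn_ge0// ltW.
rewrite /gam normrM ger0_norm// ler_wpM2l//.
apply: (le_laplace (@C0XM _ g n cg) (@subexpXM _ g n gs)
                   (@C0XM _ h n ch) (@subexpXM _ h n hs) t0) => u u0.
 have un0 : 0 <= u ^+ n by rewrite exprn_ge0// ltW.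
by rewrite normrM ger0_norm// ler_wpM2l// gh.
Qed.

Lemma gam_expn n t j : 0 < t ->
  gam n t (fun u => u ^+ j) = (n + j)`!%:R / n`!%:R / t ^+ j.
Proof.
move=> t0; have t_neq0 : t != 0 by rewrite gt_eqF.
rewrite /gam; under eq_laplace => u _ do rewrite -exprD.
rewrite laplace_expn// -addSn exprD.
have nf : n`!%:R != 0 :> R by rewrite pnatr_eq0 -lt0n fact_gt0.
have h1 : t ^+ n.+1 != 0 by rewrite expf_neq0.
have h2 : t ^+ j != 0 by rewrite expf_neq0.
by field; rewrite nf h1 h2.
Qed.

Lemma C0_monomial c j : C0 (fun u : R => c * u ^+ j).
Proof. by apply: C0Z; exact/C0X/C0_id. Qed.

Lemma subexp_monomial c j : subexp (fun u : R => c * u ^+ j).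
Proof. by apply: subexpM; [exact: subexp_cst|exact/subexpX/subexp_id]. Qed.

Lemma gam_monomial n t c j : 0 < t ->
  gam n t (fun u => c * u ^+ j) = c * ((n + j)`!%:R / n`!%:R / t ^+ j).
Proof.
move=> t0; rewrite gamZ ?gam_expn//; first exact/C0X/C0_id.
exact/subexpX/subexp_id.
Qed.

(** Serves both for the Taylor polynomial at [a] and for the majorant of its remainder, so one
    moment formula averages both. *)
Definition quartic a d0 d1 d2 d3 d4 (u : R) :=
  d0 + d1 * (u - a) + d2 * (u - a) ^+ 2 + d3 * (u - a) ^+ 3 + d4 * (u - a) ^+ 4.

Lemma C0_quartic a d0 d1 d2 d3 d4 : C0 (quartic a d0 d1 d2 d3 d4).
Proof.
have cB : C0 (fun u : R => u - a) by apply: C0D; [exact: C0_id|exact: C0_cst].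
have cX d n : C0 (fun u : R => d * (u - a) ^+ n) by apply: C0Z; exact: C0X.
by do 3 (apply: C0D; last exact: cX); apply: C0D; [exact: C0_cst|exact: C0Z].
Qed.

Lemma subexp_quartic a d0 d1 d2 d3 d4 : subexp (quartic a d0 d1 d2 d3 d4).
Proof.
have sB : subexp (fun u : R => u - a) by apply: subexpD; [exact: subexp_id|exact: subexp_cst].
have sX d n : subexp (fun u : R => d * (u - a) ^+ n).
  by apply: subexpM; [exact: subexp_cst|exact: subexpX].
by do 3 (apply: subexpD; last exact: sX); apply: subexpD;
  [exact: subexp_cst|exact: (sX d1 1%N)].
Qed.

(* Central moments of a gamma variable of mean [a = (n + 1) / t]. *)
Lemma gam_quartic n t a d0 d1 d2 d3 d4 : 0 < t -> a = n.+1%:R / t ->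
  gam n t (quartic a d0 d1 d2 d3 d4) =
  d0 + d2 * (a / t) + d3 * (2 * a / t ^+ 2)
     + d4 * (3 * a ^+ 2 / t ^+ 2 + 6 * a / t ^+ 3).
Proof.
move=> t0 aE.
(* Coefficients of the same polynomial in powers of u, whose gamma averages are quotients of
   factorials. *)
pose c0 := d0 - d1 * a + d2 * a ^+ 2 - d3 * a ^+ 3 + d4 * a ^+ 4.
pose c1 := d1 - 2 * d2 * a + 3 * d3 * a ^+ 2 - 4 * d4 * a ^+ 3.
pose c2 := d2 - 3 * d3 * a + 6 * d4 * a ^+ 2.
pose c3 := d3 - 4 * d4 * a.
have E u : 0 <= u -> quartic a d0 d1 d2 d3 d4 u =
    c0 * u ^+ 0 + (c1 * u ^+ 1 + (c2 * u ^+ 2 + (c3 * u ^+ 3 + d4 * u ^+ 4))).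
  by move=> _; rewrite /quartic /c0 /c1 /c2 /c3; ring.
rewrite (eq_gam _ _ E).
have cm := C0_monomial; have sm := subexp_monomial.
have c34 : C0 (fun u => c3 * u ^+ 3 + d4 * u ^+ 4) by exact: C0D.
have s34 : subexp (fun u => c3 * u ^+ 3 + d4 * u ^+ 4) by exact: subexpD.
have c24 : C0 (fun u => c2 * u ^+ 2 + (c3 * u ^+ 3 + d4 * u ^+ 4)) by exact: C0D.
have s24 : subexp (fun u => c2 * u ^+ 2 + (c3 * u ^+ 3 + d4 * u ^+ 4)) by exact: subexpD.
have c14 : C0 (fun u => c1 * u ^+ 1 + (c2 * u ^+ 2 + (c3 * u ^+ 3 + d4 * u ^+ 4))) by exact: C0D.
have s14 : subexp (fun u => c1 * u ^+ 1 + (c2 * u ^+ 2 + (c3 * u ^+ 3 + d4 * u ^+ 4))) by exact: subexpD.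
rewrite gamD// gamD// gamD// gamD// !gam_monomial//.
have nf : n`!%:R != 0 :> R by rewrite pnatr_eq0 -lt0n fact_gt0.
have tn0 : t != 0 by rewrite gt_eqF.
rewrite !addnS !addn0 !factS !natrM -!natr1 /c0 /c1 /c2 /c3.
have -> : a = (n%:R + 1) / t by rewrite aE -natr1.
by field; rewrite nf tn0.
Qed.

Lemma is_deriveM1 g h dg dh x : is_derive x 1 g dg -> is_derive x 1 h dh ->
  is_derive x 1 (fun y => g y * h y) (g x * dh + dg * h x).
Proof. by move=> ? ?; have := is_deriveM (f := g) (g := h); rewrite [dg * _]mulrC; apply. Qed.

Lemma is_derive_subX s x n :
  is_derive x 1 (fun y => (s - y) ^+ n) (- (n%:R * (s - x) ^+ n.-1)).
Proof.
have h : is_derive x 1 (fun y : R => s - y) (-1).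
  have := is_deriveB (is_derive_cst s x 1) (is_derive_id x 1); by rewrite sub0r.
have := @is_deriveX R R (fun y => s - y) n x 1 (-1) h.
rewrite (_ : (fun y : R => s - y) ^+ n = fun y : R => (s - y) ^+ n) ?fctE//.
by rewrite /GRing.scale /= mulrN1.
Qed.

Section taylor.
Variables (g g1 g2 g3 g4 : R -> R) (K : R).
Hypotheses (dg : dpos g g1) (dg1 : dpos g1 g2) (dg2 : dpos g2 g3) (dg3 : dpos g3 g4).
Hypothesis g4K : forall x, 0 < x -> x ^+ 2 * `|g4 x| <= K.

(** The Taylor polynomial as a function of its base point x: it equals [g s] at x = s, and its
    derivative in x telescopes to the fourth order term alone, so the remainder is an increment of
    [T s]. *)
Let T s x := g x + g1 x * (s - x) ^+ 1 + g2 x / 2 * (s - x) ^+ 2 + g3 x / 6 * (s - x) ^+ 3.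

Let dT s x : 0 < x -> is_derive x 1 (T s) (g4 x / 6 * (s - x) ^+ 3).
Proof.
move=> x0.
have h2 := is_deriveZ1 2^-1 (dg2 x0); have h3 := is_deriveZ1 6^-1 (dg3 x0).
have := is_deriveD1 (is_deriveD1 (is_deriveD1 (dg x0)
  (is_deriveM1 (dg1 x0) (is_derive_subX s x 1)))
  (is_deriveM1 h2 (is_derive_subX s x 2))) (is_deriveM1 h3 (is_derive_subX s x 3)).
rewrite (_ : (fun y => _) = T s); last first.
  by apply/funext => y; rewrite /T (mulrC 2^-1) (mulrC 6^-1).
by congr (is_derive _ _ _ _); rewrite /=; field.
Qed.

Let cT s x y : 0 < x -> {within `[x, y], continuous (T s)}.
Proof.
move=> x0; apply: derivable_within_continuous => z; rewrite in_itv/= => /andP[xz _].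
by have ? := dT s (lt_le_trans x0 xz); exact: ex_derive.
Qed.

(** Replaces the singular 1 / x^2 on [s, a] by a polynomial in x that stays controlled as s tends to
    0. The two sides agree at x = s and to first order at x = a; after clearing denominators the
    difference has nonnegative coefficients in s, p = x - s and q = a - x. *)
Let ratio_bound s x a : 0 < s -> s <= x -> x <= a ->
  (x - s) ^+ 3 / x ^+ 2 <= (s * (x - s) ^+ 3 + (a - s) ^+ 3 * (x - s)) / a ^+ 3.
Proof.
move=> s0 sx xa.
have x0 : 0 < x by exact: lt_le_trans sx.
have a0 : 0 < a by exact: lt_le_trans xa.
rewrite ler_pdivrMr ?exprn_gt0// mulrAC ler_pdivlMr ?exprn_gt0// -subr_ge0.
pose p := x - s; pose q := a - x.
have p0 : 0 <= p by rewrite subr_ge0.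
have q0 : 0 <= q by rewrite subr_ge0.
have -> : (s * (x - s) ^+ 3 + (a - s) ^+ 3 * (x - s)) * x ^+ 2 - (x - s) ^+ 3 * a ^+ 3 =
   p * (q ^+ 2 * (3 * p * s * (s + p)) + q ^+ 3 * (s * (s + 2 * p))).
  by rewrite /p /q; ring.
have s0' := ltW s0.
clearbody p q.
apply: mulr_ge0 => //; apply: addr_ge0; apply: mulr_ge0; rewrite ?exprn_ge0//.
  by rewrite mulr_ge0 ?addr_ge0// mulr_ge0// mulr_ge0.
by rewrite mulr_ge0// addr_ge0// mulr_ge0.
Qed.

(* Integrating [ratio_bound] gives the factor [z^4 (a + z) / a^3] below [a],
   with [z = a - s]; the fifth power is then absorbed by a square depending
   on the free parameter [b]. *)
Lemma taylor_remainder a b s : 0 < a -> 0 <= b -> 0 < s ->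
  `|g s - quartic a (g a) (g1 a) (g2 a / 2) (g3 a / 6) 0 s| <=
  quartic a 0 0 (K / (24 * (1 + b) ^+ 2)) (- (K * b) / (12 * a * (1 + b) ^+ 2))
    (K / (24 * a ^+ 2) + K * b ^+ 2 / (24 * a ^+ 2 * (1 + b) ^+ 2)) s.
Proof.
move=> a0 b0 s0.
have K0 : 0 <= K by apply: le_trans (g4K ltr01); rewrite mulr_ge0 ?sqr_ge0.
have -> : quartic a (g a) (g1 a) (g2 a / 2) (g3 a / 6) 0 s = T s a.
  by rewrite /quartic /T; ring.
have -> : g s = T s s by rewrite /T subrr !expr0n /=; ring.
have an0 : a != 0 by rewrite gt_eqF.
have b1 : 0 < 1 + b by rewrite ltr_wpDr.
have b1n0 : 1 + b != 0 by rewrite gt_eqF.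
(* The second summand is a square: it is dropped when s >= a, and when s < a it dominates the excess
   z^5 / a^3. *)
have -> : quartic a 0 0 (K / (24 * (1 + b) ^+ 2)) (- (K * b) / (12 * a * (1 + b) ^+ 2))
    (K / (24 * a ^+ 2) + K * b ^+ 2 / (24 * a ^+ 2 * (1 + b) ^+ 2)) s =
    K / 24 * ((s - a) ^+ 4 / a ^+ 2) +
    K / 24 * ((s - a) * (a - b * (s - a)) / (a * (1 + b))) ^+ 2.
  by rewrite /quartic; field; rewrite an0 b1n0.
have g4x x : 0 < x -> `|g4 x| <= K / x ^+ 2.
  by move=> x0; rewrite ler_pdivlMr ?exprn_gt0// mulrC g4K.
have [as_|sa] := leP a s.
  apply: (@le_trans _ _ (K / 24 * ((s - a) ^+ 4 / a ^+ 2))); last first.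
    by rewrite lerDl mulr_ge0 ?sqr_ge0// divr_ge0.
  pose F x := - (K / (24 * a ^+ 2)) * (s - x) ^+ 4.
  have dF x : is_derive x 1 F (- (K / (24 * a ^+ 2)) * - (4 * (s - x) ^+ 3)).
    exact: is_deriveZ1 (is_derive_subX s x 4).
  have -> : K / 24 * ((s - a) ^+ 4 / a ^+ 2) = F s - F a.
    by rewrite /F subrr expr0n /=; field.
  apply: (@le_increment R (T s) F (fun x => g4 x / 6 * (s - x) ^+ 3)
    (fun x => - (K / (24 * a ^+ 2)) * - (4 * (s - x) ^+ 3))) => //.
  - exact: cT.
  - apply: derivable_within_continuous => x _; have ? := dF x; exact: ex_derive.
  - by move=> x /andP[ax _]; apply: dT; exact: lt_trans ax.
  - move=> x /andP[ax xs].
    have x0 : 0 < x by exact: lt_trans ax.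
    have sx3 : 0 <= (s - x) ^+ 3 by rewrite exprn_ge0// subr_ge0 ltW.
    rewrite normrM (ger0_norm sx3) normrM (@ger0_norm _ 6^-1)//.
    have -> : - (K / (24 * a ^+ 2)) * - (4 * (s - x) ^+ 3) = K / a ^+ 2 / 6 * (s - x) ^+ 3.
      by field.
    rewrite !ler_wpM2r//; apply: le_trans (g4x x x0) _.
    by rewrite ler_wpM2l// lef_pV2 ?posrE ?exprn_gt0// ler_sqr ?nnegrE ltW.
pose z := a - s.
have z0 : 0 <= z by rewrite subr_ge0 ltW.
have za : z <= a by rewrite gerBl ltW.
apply: (@le_trans _ _ (K / 24 * (z ^+ 4 * (a + z) / a ^+ 3))); last first.
  have -> : (s - a) ^+ 4 = z ^+ 4 by rewrite /z; ring.
  rewrite -mulrDr ler_wpM2l ?divr_ge0//.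
  have -> : z ^+ 4 * (a + z) / a ^+ 3 = z ^+ 4 / a ^+ 2 + z ^+ 2 * (z ^+ 3 / a ^+ 3) by field.
  rewrite lerD2l.
  have -> : ((s - a) * (a - b * (s - a)) / (a * (1 + b))) ^+ 2 =
      z ^+ 2 * ((a + b * z) / (a * (1 + b))) ^+ 2.
    by rewrite /z; field; rewrite an0 b1n0.
  rewrite ler_wpM2l ?sqr_ge0//.
  have w0 : 0 <= z / a by rewrite divr_ge0// ltW.
  have w1 : z / a <= 1 by rewrite ler_pdivrMr// mul1r.
  (* The right side is the average of 1 and z / a with weights 1 and b, and z / a <= 1. *)
  have wr : z / a <= (a + b * z) / (a * (1 + b)).
    rewrite ler_pdivrMr// mulrAC ler_pdivlMr ?mulr_gt0//.
    by rewrite -subr_ge0 (_ : _ - _ = a * (a - z)) ?mulr_ge0 ?subr_ge0 ?(ltW a0)//; ring.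
  have -> : z ^+ 3 / a ^+ 3 = (z / a) * (z / a) ^+ 2 by field.
  apply: (@le_trans _ _ ((z / a) ^+ 2)); first by rewrite ler_piMl ?sqr_ge0.
  by rewrite ler_sqr ?nnegrE// (le_trans w0).
(* A primitive in x of K / 6 times the right side of [ratio_bound]. *)
pose F x := K / (24 * a ^+ 3) * s * (s - x) ^+ 4 + K / (12 * a ^+ 3) * (a - s) ^+ 3 * (s - x) ^+ 2.
pose F' x := K / (24 * a ^+ 3) * s * - (4 * (s - x) ^+ 3) +
  K / (12 * a ^+ 3) * (a - s) ^+ 3 * - (2 * (s - x) ^+ 1).
have dF x : is_derive x 1 F (F' x).
  by apply: is_deriveD1; apply: is_deriveZ1; exact: is_derive_subX.
have -> : K / 24 * (z ^+ 4 * (a + z) / a ^+ 3) = F a - F s.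
  by rewrite /F /z subrr !expr0n /=; field.
rewrite distrC.
apply: (@le_increment R (T s) F (fun x => g4 x / 6 * (s - x) ^+ 3) F') => //.
- exact: ltW.
- exact: cT.
- apply: derivable_within_continuous => x _; have ? := dF x; exact: ex_derive.
- by move=> x /andP[sx _]; apply: dT; exact: lt_trans sx.
move=> x /andP[sx xa].
have x0 : 0 < x by exact: lt_trans sx.
have -> : (s - x) ^+ 3 = - (x - s) ^+ 3 by ring.
have xs3 : 0 <= (x - s) ^+ 3 by rewrite exprn_ge0// subr_ge0 ltW.
rewrite mulrN normrN normrM (ger0_norm xs3) normrM (@ger0_norm _ 6^-1)//.
apply: (@le_trans _ _ (K / 6 * ((x - s) ^+ 3 / x ^+ 2))).
  have -> : K / 6 * ((x - s) ^+ 3 / x ^+ 2) = K / x ^+ 2 / 6 * (x - s) ^+ 3.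
    by field; rewrite gt_eqF.
  by rewrite !ler_wpM2r//; exact: g4x.
apply: (@le_trans _ _ (K / 6 * ((s * (x - s) ^+ 3 + (a - s) ^+ 3 * (x - s)) / a ^+ 3))).
  by rewrite ler_wpM2l ?divr_ge0// ratio_bound// ltW.
rewrite le_eqVlt; apply/orP; left; apply/eqP.
by rewrite /F'; field.
Qed.

End taylor.

End gamma_averages.

(** * Approximation error *)

Section approximation_error.
Context {R : realType}.
Variables (g g1 g2 g3 g4 : R -> R) (B K3 K : R).
Hypotheses (cg : C0 g) (dg : dpos g g1) (dg1 : dpos g1 g2) (dg2 : dpos g2 g3)
  (dg3 : dpos g3 g4).
Hypothesis g2B : forall x, 0 < x -> `|g2 x| <= B.
Hypothesis g4K : forall x, 0 < x -> x ^+ 2 * `|g4 x| <= K.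
Implicit Types (a b s t u x y : R) (n k : nat).

Lemma dpos_within (h h' : R -> R) x y : dpos h h' -> 0 < x ->
  {within `[x, y], continuous h}.
Proof.
move=> dh x0; apply: derivable_within_continuous => z; rewrite in_itv/= => /andP[xz _].
by have ? := dh z (lt_le_trans x0 xz); exact: ex_derive.
Qed.

Lemma is_derive_linear c x : is_derive x 1 (fun y : R => c * y) c.
Proof. by have := is_deriveZ1 c (is_derive_id x (1 : R)); rewrite mulr1. Qed.

Lemma continuous_linear (c : R) : continuous (fun y : R => c * y).
Proof. by move=> x; apply: cvgM; [exact: cvg_cst|exact: cvg_id]. Qed.

Let g1_lipschitz x y : 0 < x -> x <= y -> `|g1 y - g1 x| <= B * (y - x).
Proof.
move=> x0 xy; rewrite mulrBr.
apply: (@le_increment R g1 (fun y => B * y) g2 (fun=> B)) => //.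
- exact: dpos_within dg1 x0.
- by apply: continuous_subspaceT; exact: continuous_linear.
- by move=> z /andP[xz _]; apply: dg1; exact: lt_trans xz.
- by move=> z _; exact: is_derive_linear.
- by move=> z /andP[xz _]; apply: g2B; exact: lt_trans xz.
Qed.

(** The endpoint y = 0 is allowed, by continuity of [g] there: the first interpolation cell
    [0, 1 / t] needs it. *)
Lemma taylor2 u y : 0 < u -> 0 <= y ->
  `|g y - g u - g1 u * (y - u)| <= B / 2 * (y - u) ^+ 2.
Proof.
move=> u0 y0.
pose h x := g x + (- g1 u) * x.
have ch : C0 h by apply: C0D => //; exact: C0Z C0_id.
have dh : dpos h (fun x => g1 x + - g1 u).
  by move=> x x0; apply: is_deriveD1 (dg x0) (is_derive_linear _ _).
have -> : g y - g u - g1 u * (y - u) = h y - h u by rewrite /h; ring.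
pose F x := - (B / 2) * (u - x) ^+ 2.
have dF x : is_derive x 1 F (B * (u - x)).
  have := is_deriveZ1 (- (B / 2)) (is_derive_subX u x 2).
  by congr (is_derive _ _ _ _); rewrite /=; field.
have cF x z : {within `[x, z], continuous F}.
  by apply: derivable_within_continuous => w _; have ? := dF w; exact: ex_derive.
have [uy|yu] := leP u y.
  pose F2 x := - F x.
  have dF2 x : is_derive x 1 F2 (B * (x - u)).
    have := is_deriveN (dF x); congr (is_derive _ _ _ _); ring.
  have -> : B / 2 * (y - u) ^+ 2 = F2 y - F2 u by rewrite /F2 /F subrr; ring.
  apply: (@le_increment R h F2 (fun x => g1 x + - g1 u) (fun x => B * (x - u))) => //.
  - exact: C0_within ch (ltW u0).
  - by apply: derivable_within_continuous => w _; have ? := dF2 w; exact: ex_derive.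
  - by move=> x /andP[ux _]; apply: dh; exact: lt_trans ux.
  - by move=> x /andP[ux _]; apply: g1_lipschitz => //; exact: ltW.
rewrite distrC.
have -> : B / 2 * (y - u) ^+ 2 = F u - F y by rewrite /F subrr; ring.
apply: (@le_increment R h F (fun x => g1 x + - g1 u) (fun x => B * (u - x))) => //.
- exact: ltW.
- exact: C0_within.
- by move=> x /andP[yx _]; apply: dh; exact: le_lt_trans yx.
- move=> x /andP[yx xu]; rewrite distrC; apply: g1_lipschitz; last exact: ltW.
  exact: le_lt_trans yx.
Qed.

(** A bounded second derivative gives at most quadratic growth, seen by expanding at 1. *)
Lemma D1_subexp : subexp g.
Proof.
have s1 : subexp (fun u : R => u - 1) by apply: subexpD; [exact: subexp_id|exact: subexp_cst].
have sn : subexp (fun u : R => `|u - 1|) by apply: le_subexp s1 => u _; rewrite normr_id.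
apply: (@le_subexp _ _ (fun u => `|g 1| + (`|g1 1| * `|u - 1| + B / 2 * (u - 1) ^+ 2))).
  move=> u u0; have t2 := taylor2 ltr01 u0.
  have -> : g u = g 1 + (g1 1 * (u - 1) + (g u - g 1 - g1 1 * (u - 1))) by ring.
  apply: le_trans (ler_norm _).
  apply: le_trans (ler_normD _ _) _; rewrite lerD2l.
  by apply: le_trans (ler_normD _ _) _; rewrite normrM lerD2l.
apply: subexpD; first exact: subexp_cst.
apply: subexpD; apply: subexpM; try exact: subexp_cst; first exact: sn.
exact: subexpX.
Qed.

(** Interpolation between derivatives: over [u, 2 u] the increment of [g2] is at most 2 B, and it
    differs from u g3(u) by at most K, since [g3] varies there by at most K / u. This makes the
    middle norm of the error bound finite on the whole class. *)
Lemma third_derivative_bound u : 0 < u -> u * `|g3 u| <= 2 * B + K.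
Proof.
move=> u0; have u20 : 0 < 2 * u by rewrite mulr_gt0.
have uu : u <= 2 * u by rewrite ler_peMl ?ltW// ltr1n.
have K0 : 0 <= K by apply: le_trans (g4K ltr01); rewrite mulr_ge0 ?sqr_ge0.
have u2 : 0 < u ^+ 2 by rewrite exprn_gt0.
have lip x : u <= x -> `|g3 x - g3 u| <= K / u ^+ 2 * (x - u).
  move=> ux; rewrite mulrBr.
  apply: (@le_increment R g3 (fun y => K / u ^+ 2 * y) g4 (fun=> K / u ^+ 2)) => //.
  - exact: dpos_within dg3 u0.
  - by apply: continuous_subspaceT; exact: continuous_linear.
  - by move=> z /andP[uz _]; apply: dg3; exact: lt_trans uz.
  - by move=> z _; exact: is_derive_linear.
  - move=> z /andP[uz _]; have z0 := lt_trans u0 uz.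
    rewrite ler_pdivlMr// mulrC; apply: le_trans (g4K z0).
    by rewrite ler_wpM2r// ler_sqr ?nnegrE ltW.
pose h x := g2 x + (- g3 u) * x.
have dh : dpos h (fun x => g3 x + - g3 u).
  by move=> x x0; apply: is_deriveD1 (dg2 x0) (is_derive_linear _ _).
have hK : `|h (2 * u) - h u| <= K.
  have -> : K = K / u * (2 * u) - K / u * u by field; rewrite gt_eqF.
  apply: (@le_increment R h (fun y => K / u * y) (fun x => g3 x + - g3 u) (fun=> K / u)) => //.
  - exact: dpos_within dh u0.
  - by apply: continuous_subspaceT; exact: continuous_linear.
  - by move=> x /andP[ux _]; apply: dh; exact: lt_trans ux.
  - by move=> z _; exact: is_derive_linear.
  - move=> x /andP[ux xu]; apply: le_trans (lip x (ltW ux)) _.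
    have -> : K / u = K / u ^+ 2 * u by field; rewrite gt_eqF.
    by rewrite ler_wpM2l ?divr_ge0 ?(ltW u2)//; lra.
have -> : u * `|g3 u| = `|g2 (2 * u) - g2 u - (h (2 * u) - h u)|.
  rewrite -{1}(gtr0_norm u0) -normrM; congr `|_|; rewrite /h; ring.
apply: le_trans (ler_normB _ _) _; apply: lerD hK.
apply: le_trans (ler_normB _ _) _.
have := g2B u20; have := g2B u0; lra.
Qed.

Hypothesis g3K : forall x, 0 < x -> x * `|g3 x| <= K3.

Let K0 : 0 <= K.
Proof. by apply: le_trans (g4K ltr01); rewrite mulr_ge0 ?sqr_ge0. Qed.

(** At the node k = n + 1 the truncated arguments are exactly the integers 2 k - 1 and k - 1, whence
    shapes 2 k and k. *)
Lemma M2_nodeE t n : 0 < t ->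
  M2_node t g n.+1 = 2 * gam (n.*2).+1 (2 * t) g - gam n t g.
Proof.
move=> t0; have sg := D1_subexp.
have t20 : 0 < 2 * t by rewrite mulr_gt0.
rewrite /M2_node /= (@LstarE _ (n.*2).+1)// ?(@LstarE _ n)//.
- have -> : t * ((n.+1%:R - 1) / t) = n%:R by rewrite -natr1; field; rewrite gt_eqF.
  exact: natrK.
- have -> : 2 * t * ((2 * n.+1%:R - 1) / (2 * t)) = (n.*2).+1%:R.
    rewrite -addnn -!natr1 natrD; field; by rewrite gt_eqF.
  exact: natrK.
Qed.

(* With [b = k / 3] the sum of the two remainders at the node [k / t] is
   [K / (16 t ^ 2) (3 + 5 / k) (1 + (k / (k + 3)) ^ 2)]. *)
Lemma node_error t n : 0 < t ->
  `|M2_node t g n.+1 - g (n.+1%:R / t)| <=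
  K3 / (6 * t ^+ 2) + 9 * K / (16 * t ^+ 2).
Proof.
move=> t0; have sg := D1_subexp.
have t20 : 0 < 2 * t by rewrite mulr_gt0.
set k : R := n.+1%:R; set a := k / t.
have k0 : 0 < k by rewrite ltr0n.
have k1 : 1 <= k by rewrite ler1n.
have a0 : 0 < a by rewrite divr_gt0.
have b0 : 0 <= k / 3 by rewrite divr_ge0// ltW.
have aE2 : a = (n.*2).+1.+1%:R / (2 * t).
  by rewrite -doubleS -muln2 natrM /a /k; field; rewrite gt_eqF.
have aE1 : a = n.+1%:R / t by [].
clearbody k.
pose T := quartic a (g a) (g1 a) (g2 a / 2) (g3 a / 6) 0.
(* The value at which the quadratic and cubic terms of the majorant cancel once the two averages are
   added with weights 2 and 1; at k = 1 it also minimises their sum over b. *)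
pose b := k / 3.
pose D2 := K / (24 * (1 + b) ^+ 2).
pose D3 := - (K * b) / (12 * a * (1 + b) ^+ 2).
pose D4 := K / (24 * a ^+ 2) + K * b ^+ 2 / (24 * a ^+ 2 * (1 + b) ^+ 2).
have cT : C0 T by exact: C0_quartic.
have sT : subexp T by exact: subexp_quartic.
have cE : C0 (fun u => g u - T u) by apply: C0D => //; exact: C0N.
have sE : subexp (fun u => g u - T u).
  by apply: subexpD => //; apply: le_subexp sT => u _; rewrite normrN.
have remainder N tau : 0 < tau -> `|gam N tau g - gam N tau T| <= gam N tau (quartic a 0 0 D2 D3 D4).
  move=> tau0.
  have -> : gam N tau g - gam N tau T = gam N tau (fun u => g u - T u).
    apply/eqP; rewrite subr_eq -gamD//; apply/eqP.
    by apply: eq_gam => u _; rewrite subrK.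
  apply: le_gam => //; [exact: C0_quartic|exact: subexp_quartic|].
  by move=> u u0; exact: (taylor_remainder dg dg1 dg2 dg3 g4K a0 b0 u0).
rewrite M2_nodeE//.
have r1 := remainder (n.*2).+1 _ t20; have r2 := remainder n _ t0.
move: r1 r2; rewrite /T !gam_quartic// => r1 r2.
have tn0 : t != 0 by rewrite gt_eqF.
have kn0 : k != 0 by rewrite gt_eqF.
have k3 : 0 < k + 3 by rewrite addr_gt0.
have k3n0 : k + 3 != 0 by rewrite gt_eqF.
have b1 : 1 + b = (k + 3) / 3 by rewrite /b; field.
set e1 := gam (n.*2).+1 (2 * t) g - _ in r1; set e2 := gam n t g - _ in r2.
have -> : 2 * gam (n.*2).+1 (2 * t) g - gam n t g - g a = - (a * g3 a / (6 * t ^+ 2)) + (2 * e1 - e2).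
  by rewrite /e1 /e2; field; rewrite tn0.
apply: le_trans (ler_normD _ _) _; apply: lerD.
  rewrite normrN normrM normrM (gtr0_norm a0) normfV.
  rewrite (@gtr0_norm _ (6 * t ^+ 2)) ?mulr_gt0 ?exprn_gt0//.
  by rewrite ler_wpM2r ?g3K// invr_ge0 mulr_ge0// sqr_ge0.
apply: le_trans (ler_normB _ _) _; rewrite normrM (@ger0_norm _ 2)//.
apply: le_trans (lerD (ler_wpM2l _ r1) r2) _ => //.
rewrite /D2 /D3 /D4 b1 /b /a.
have -> : 9 * K / (16 * t ^+ 2) = K / t ^+ 2 * (9 / 16) by field.
rewrite [leLHS](_ : _ = K / t ^+ 2 * ((3 * k + 5) / (16 * k) * (1 + k ^+ 2 / (k + 3) ^+ 2))); last first.
  by field; rewrite tn0 kn0 k3n0.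
rewrite ler_wpM2l ?divr_ge0 ?exprn_ge0 ?(ltW t0)//.
rewrite -subr_ge0.
(* Expanded at the smallest node k = 1, where the factor is 17/32, the numerator has only positive
   coefficients. *)
have -> : 9 / 16 - (3 * k + 5) / (16 * k) * (1 + k ^+ 2 / (k + 3) ^+ 2) =
   (3 * (k - 1) ^+ 3 + 35 * (k - 1) ^+ 2 + 85 * (k - 1) + 8) / (16 * k * (k + 3) ^+ 2).
  by field; rewrite kn0 k3n0.
have kk : 0 <= k - 1 by rewrite subr_ge0.
apply: divr_ge0; first by rewrite !addr_ge0// mulr_ge0// exprn_ge0.
by rewrite mulr_ge0 ?sqr_ge0// mulr_ge0// ltW.
Qed.

Lemma M2_error t u : 0 < t -> 0 <= u ->
  `|M2 t g u - g u| <= B / (8 * t ^+ 2) + K3 / (6 * t ^+ 2) + 9 * K / (16 * t ^+ 2).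
Proof.
move=> t0 u0; have tn0 : t != 0 by rewrite gt_eqF.
have t2 : 0 < t ^+ 2 by rewrite exprn_gt0.
have B0 : 0 <= B by apply: le_trans (g2B ltr01).
have K30 : 0 <= K3 by apply: le_trans (g3K ltr01); rewrite mulr_ge0.
set E := K3 / (6 * t ^+ 2) + 9 * K / (16 * t ^+ 2).
have E0 : 0 <= E by rewrite addr_ge0// divr_ge0// mulr_ge0// ltW.
have BE0 : 0 <= B / (8 * t ^+ 2) by rewrite divr_ge0// mulr_ge0// ltW.
rewrite -addrA -/E.
have node k : `|M2_node t g k - g (k%:R / t)| <= E.
  case: k => [|k]; last exact: node_error.
  by rewrite /M2_node /= mul0r subrr normr0.
rewrite /M2; set k := Num.truncn (t * u).
case: eqP => [tuk|/eqP tuk].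
  have -> : g u = g (k%:R / t) by rewrite -tuk mulrC mulKf.
  by apply: le_trans (node k) _; rewrite lerDr.
have tu0 : 0 <= t * u by rewrite mulr_ge0// ltW.
have /andP[k1 k2] : k%:R <= t * u < k.+1%:R by exact: truncn_itv.
(* The point 0 is a node, so it is excluded here; the expansion at u requires u > 0. *)
have up : 0 < u.
  rewrite lt_neqAle u0 andbT; apply: contraNneq tuk => u00.
  by rewrite /k -u00 mulr0 truncn0.
set l := t * u - k%:R; have -> : k.+1%:R - t * u = 1 - l by rewrite /l -natr1; ring.
have l0 : 0 <= l by rewrite subr_ge0.
have l1 : 0 <= 1 - l by rewrite /l; move: k2; rewrite -natr1; lra.
have y1 := taylor2 up (_ : 0 <= k.+1%:R / t).
have y2 := taylor2 up (_ : 0 <= k%:R / t).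
have {}y1 := y1 (divr_ge0 (ler0n _ _) (ltW t0)).
have {}y2 := y2 (divr_ge0 (ler0n _ _) (ltW t0)).
have e1 : k.+1%:R / t - u = (1 - l) / t by rewrite /l -natr1; field.
have e2 : k%:R / t - u = - (l / t) by rewrite /l; field.
rewrite e1 in y1; rewrite e2 in y2.
set n1 := M2_node t g k.+1; set n0 := M2_node t g k.
(* The two terms in [g1 u] cancel, which separates the interpolation error from a convex combination
   of node errors. *)
have -> : l * n1 + (1 - l) * n0 - g u =
  (l * (g (k.+1%:R / t) - g u - g1 u * ((1 - l) / t)) +
   (1 - l) * (g (k%:R / t) - g u - g1 u * - (l / t))) +
  (l * (n1 - g (k.+1%:R / t)) + (1 - l) * (n0 - g (k%:R / t))) by field.
apply: le_trans (ler_normD _ _) _; apply: lerD; last first.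
  apply: le_trans (ler_normD _ _) _.
  rewrite !normrM (ger0_norm l0) (ger0_norm l1).
  have -> : E = l * E + (1 - l) * E by ring.
  by apply: lerD; rewrite ler_wpM2l// node.
apply: le_trans (ler_normD _ _) _.
rewrite !normrM (ger0_norm l0) (ger0_norm l1).
apply: le_trans (lerD (ler_wpM2l l0 y1) (ler_wpM2l l1 y2)) _.
(* Here l (1 - l)^2 + (1 - l) l^2 = l (1 - l), and 4 l (1 - l) = 1 - (2 l - 1)^2. *)
rewrite [leLHS](_ : _ = B / (8 * t ^+ 2) * (1 - (2 * l - 1) ^+ 2)); last by field.
by rewrite ler_piMr// gerBl sqr_ge0.
Qed.

Lemma D1_Lstar_defined t : 0 < t -> Lstar_defined t g.
Proof.
move=> t0; have sg := D1_subexp; split => //.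
- exists (t / 2); split; first by rewrite divr_ge0// ltW.
    by rewrite ltr_pdivrMr// ltr_pMr// ltr1n.
  have [C gC] := sg (t / 2) (divr_gt0 t0 (ltr0n _ 2)).
  exists C; near=> u; apply: gC; near: u; exact: nbhs_pinfty_ge.
- exact: laplace_integrable.
- by move=> n; have [_] := laplace_derive1n n cg sg; apply.
Unshelve. all: by end_near. Qed.

End approximation_error.

Lemma M2_bound {R : realType} (g : R -> R) : classD1 g ->
  forall t : R, 0 < t ->
    let bound := ((1 / (8 * t ^+ 2))%:E * wnorm 0 (dern 2 g)
                  + (1 / (6 * t ^+ 2))%:E * wnorm 1 (dern 3 g)
                  + (9 / (16 * t ^+ 2))%:E * wnorm 2 (dern 4 g))%E in
    [/\ M2_defined t g,
        (supnorm `[0%R, +oo[ (fun u => (M2 t g u - g u)%R) <= bound)%E &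
        (bound < +oo)%E].
Proof.
move=> [cn /wnormE[B BE g2B] /wnormE[K KE g4K]] t t0 bound.
have cg := Cn_C0 cn.
have dg : dpos g (dern 1 g).
  by apply: dpos_eq (Cn_dpos cn (isT : (0 < 4)%N)) => u u0; rewrite dern_gt0.
have dg1 := Cn_dpos cn (isT : (1 < 4)%N).
have dg2 := Cn_dpos cn (isT : (2 < 4)%N).
have dg3 := Cn_dpos cn (isT : (3 < 4)%N).
have {}g2B u : 0 < u -> `|dern 2 g u| <= B by move=> u0; rewrite -[leLHS]mul1r g2B.
have g3b := third_derivative_bound dg2 dg3 g2B g4K.
have /wnormE[K3 K3E g3K] : (wnorm 1 (dern 3 g) < +oo)%E.
  by apply: le_lt_trans (ltry (2 * B + K)); apply: wnorm_le.
have boundE : bound = (B / (8 * t ^+ 2) + K3 / (6 * t ^+ 2) + 9 * K / (16 * t ^+ 2))%:E.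
  rewrite /bound BE K3E KE -!EFinM -!EFinD; congr EFin.
  by field; rewrite gt_eqF.
split; last by rewrite boundE ltry.
- by split; apply: (D1_Lstar_defined cg dg dg1 g2B); rewrite ?mulr_gt0.
- rewrite boundE; apply: ge_ereal_sup => _ [u /= + <-].
  rewrite in_itv/= andbT => u0; rewrite lee_fin.
  exact: (M2_error cg dg dg1 dg2 dg3 g2B g4K g3K t0 u0).
Qed.

Theorem corollary2p1 (R : realType) (d : measure_display)
    (Omega : measurableType d) (P : probability Omega R) (Z : {RV P >-> R})
    (phi : R) (v m : R -> R) :
  let F := fun u : R => fine (cdf Z u) in
  let f := dern 1 F in
  0 < phi -> phi < 1 ->
  (forall w, 0 <= Z w) -> F 0 = 0 ->
  distribution P Z `<< @lebesgue_measure R ->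
  locally_bounded v ->
  locally_bounded m -> renewal_solution phi f v m ->
  ('V_P[Z] < +oo)%E ->
  Cn0 2 F -> Cn0 2 v ->
  Cn 2 (dern 1 f) -> Cn 2 (dern 2 v) ->
  (Iabs 0 (dern 2 f) < +oo)%E -> (Iabs 2 (dern 2 f) < +oo)%E ->
  (wnorm 2 (w1 phi f v m) < +oo)%E -> (wnorm 2 (w2 phi f v m) < +oo)%E ->
  (wnorm 2 (dern 2 (w1 phi f v m)) < +oo)%E ->
  (wnorm 2 (dern 2 (w2 phi f v m)) < +oo)%E ->
  classD1 m /\
  forall t : R, 0 < t ->
    let bound := ((1 / (8 * t ^+ 2))%:E * wnorm 0 (dern 2 m)
                  + (1 / (6 * t ^+ 2))%:E * wnorm 1 (dern 3 m)
                  + (9 / (16 * t ^+ 2))%:E * wnorm 2 (dern 4 m))%E in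
    [/\ M2_defined t m,
        (supnorm `[0%R, +oo[ (fun u => (M2 t m u - m u)%R) <= bound)%E &
        (bound < +oo)%E].
Proof.
move=> F f phi0 phi1 Z0 F0 _ _ bm hm VZ cF cv cf1 cv2 I0 I2 w1b w2b w1b2 w2b2.
suff D1m : classD1 m by split=> //; exact: M2_bound.
have cf : C0 f := density_C0 cF.
have cv0 : C0 v := Cn_C0 (Cn0_Cn cv).
have [a [b [a0 ab fn0]]] := density_neq0 F0 cF.
have cm : C0 m := renewal_solution_C0 cf cv0 bm hm a0 ab fn0.
have df : dpos f (dern 1 f).
  apply: dpos_eqr (Cn_dpos (Cn0_Cn cF) (ltnSn 1)) => u u0.
  by rewrite (dern_dern 1 1 F u0).
have fM := density_moment2 Z0 VZ cF.
have [B [K [cnm m2B m4K]]] := renewal_solution_D1 phi0 phi1 cf df cm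
  (density_ge0 cF) (density_le1 F0 cF) fM (renewal_solutionE hm) cv cf1 cv2 I0 I2
  w1b w2b w1b2 w2b2.
split; first exact: cnm.
- apply: le_lt_trans (ltry B); apply: wnorm_le => u u0.
  by rewrite expr0 mul1r (dern_gt0 2 m u0); exact: m2B.
- apply: le_lt_trans (ltry K); apply: wnorm_le => u u0.
  by rewrite (dern_gt0 4 m u0); exact: m4K.
Qed.
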